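(* Let $q$ be any prime power. Assume $f,g\in\mathbb F_q(X)$ are in Class III-b, $\theta(f)=\theta(g)$, and $\lambda(f)=\lambda(g)\notin\{1,5/2\}$. Then $f$ and $g$ are equivalent over $\mathbb F_q$.
   Context: $\mathbb F_q$ is the field with $q$ elements, $\overline{\mathbb F}_q$ an algebraic closure. For a field $K$, $\mathrm{PGL}(2,K)$ is the group of $(aX+b)/(cX+d)$, $a,b,c,d\in K$, $ad-bc\neq0$; $f,g\in K(X)$ are equivalent over $K$ if $g=\psi\circ f\circ\phi$ with $\psi,\phi\in\mathrm{PGL}(2,K)$. For $s,t\in\mathbb F_q$ with $t(1+s+t)\neq0$, $f_{s,t}=\frac{X^3+sX+t}{X(X-1)}$ and $G_{s,t}=X^4-2X^3-sX^2-2tX+t$. Class III-b is the set of $f\in\mathbb F_q(X)$ equivalent over $\mathbb F_q$ to some such $f_{s,t}$ with $G_{s,t}$ a product of two distinct irreducible quadratics over $\mathbb F_q$. Ramification index at $a\in\mathbb P^1(\overline{\mathbb F}_q)$: $e_f(a)=\nu_{X-a}(f(X)-f(a))$ if $a,f(a)\ne\infty$; $\nu_{X-a}(1/f)$ if $a\ne\infty=f(a)$; $\nu_X(f(1/X)-f(\infty))$ if $a=\infty\ne f(\infty)$; $\nu_X(1/f(1/X))$ if $a=\infty=f(\infty)$; ramification points are the $a$ with $e_f(a)>1$. $\theta$: every degree-3 $f\in\overline{\mathbb F}_q(X)$ having a point of index $2$ is equivalent over $\overline{\mathbb F}_q$ to exactly one of $\frac{X^3+1}{X}$, $\frac{X^3+X^2+t}{X}$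 ($0\ne t\in\overline{\mathbb F}_q$), and $\theta(f)=0$, resp. $1/t$; functions in Class III-b have a point of index 2. $\lambda$: a function $f$ in Class III-b has exactly four ramification points, of the form $\rho_1,\rho_1^q,\rho_2,\rho_2^q$ (with $\rho_i$ of degree 2 over $\mathbb F_q$); with the cross ratio $C(x_1,x_2,x_3,x_4)=\frac{(x_1-x_3)(x_2-x_4)}{(x_1-x_4)(x_2-x_3)}$, set $\lambda(f)=C+C^{-1}$ where $C=C(\rho_1,\rho_1^q,\rho_2,\rho_2^q)$ (this does not depend on the labeling). *)

(* Defs.v *)
From HB Require Import structures.
From mathcomp Require Import all_boot all_order all_algebra all_field.
Set Implicit Arguments.
Unset Strict Implicit.
Unset Printing Implicit Defensive.
Import GRing.Theory.
Local Open Scope ring_scope.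

Section RationalFunctions.
Variable K : fieldType.
Implicit Types (p d : {poly K}) (f g h psi phi : {fraction {poly K}}).

Definition ratfun p d : {fraction {poly K}} := tofrac p / tofrac d.

Definition ratcst (c : K) : {fraction {poly K}} := tofrac c%:P.

(* Lowest terms: [repr f] is some pair representing [f], not necessarily
   coprime, so the gcd is divided out (only a constant factor, common to both,
   depends on the representative). *)
Definition ratnum f : {poly K} :=
  let r := frac (repr f) in r.1 %/ gcdp r.1 r.2.
Definition ratden f : {poly K} :=
  let r := frac (repr f) in r.2 %/ gcdp r.1 r.2.

Definition poly_at p g : {fraction {poly K}} := (map_poly ratcst p).[g].

(* [f \o g], that is f(g(X)); junk value 0 if [g] is a constant pole of [f]. *)
Definition ratcomp f g : {fraction {poly K}} :=
  poly_at (ratnum f) g / poly_at (ratden f) g.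

(* PGL(2, K), as a set of rational functions. *)
Definition is_PGL2 psi : Prop :=
  exists a b c d : K,
    a * d - b * c != 0 /\
    psi = ratfun (a *: 'X + b%:P) (c *: 'X + d%:P).

Definition equivalent f g : Prop :=
  exists psi phi,
    [/\ is_PGL2 psi, is_PGL2 phi & g = ratcomp psi (ratcomp f phi)].

(* The valuation nu_(X - a), for nonzero arguments: [valuation a 0] is 0
   rather than +oo. *)
Definition valuation (a : K) f : int :=
  (mup a (ratnum f))%:Z - (mup a (ratden f))%:Z.

(* P^1(K) is [option K], with [None] as the point at infinity. *)
Definition value_at f (a : K) : option K :=
  if root (ratden f) a then None
  else Some ((ratnum f).[a] / (ratden f).[a]).

Definition ram_index_fin f (a : K) : int :=
  if value_at f a is Some c then valuation a (f - ratcst c)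
  else valuation a (f^-1).

(* Both f(oo) and the index at oo are read off f(1/X) at 0. *)
Definition ram_index f (a : option K) : int :=
  if a is Some a' then ram_index_fin f a'
  else ram_index_fin (ratcomp f (ratfun 1 'X)) 0.

Definition ramified f (a : option K) : Prop := 1 < ram_index f a.

Definition f_st (s t : K) : {fraction {poly K}} :=
  ratfun ('X^3 + s *: 'X + t%:P) ('X * ('X - 1)).

Definition G_st (s t : K) : {poly K} :=
  'X^4 - 2 *: 'X^3 - s *: 'X^2 - (2 * t) *: 'X + t%:P.

(* As [G_st s t] is monic, its quadratic factors are normalised to be monic;
   otherwise [h] and [c *: h] would count as distinct factors. *)
Definition classIIIb f : Prop :=
  exists s t : K,
    [/\ t * (1 + s + t) != 0,
        (exists h1 h2 : {poly K},
           [/\ h1 \is monic /\ h2 \is monic,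
               size h1 = 3 /\ size h2 = 3,
               irreducible_poly h1 /\ irreducible_poly h2,
               h1 <> h2 & G_st s t = h1 * h2])
      & equivalent f (f_st s t)].

Definition cross_ratio (x1 x2 x3 x4 : K) : K :=
  ((x1 - x3) * (x2 - x4)) / ((x1 - x4) * (x2 - x3)).

(* The graph of theta on K(X), for K algebraically closed. Its domain needs no
   separate mention: the two normal forms have degree 3, with index 2 at oo. *)
Definition theta_is f (u : K) : Prop :=
  (equivalent f (ratfun ('X^3 + 1) 'X) /\ u = 0) \/
  (exists t : K,
     [/\ t != 0, equivalent f (ratfun ('X^3 + 'X^2 + t%:P) 'X) & u = t^-1]).

End RationalFunctions.

Section OverFiniteField.
Variables (F : finFieldType) (L : closedFieldType) (iota : {rmorphism F -> L}).

Definition ratmap (f : {fraction {poly F}}) : {fraction {poly L}} :=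
  ratfun (map_poly iota (ratnum f)) (map_poly iota (ratden f)).

Definition degree_two (x : L) : Prop :=
  exists p : {poly F},
    [/\ irreducible_poly p, size p = 3 & root (map_poly iota p) x].

(* The graph of lambda. *)
Definition lambda_is (f : {fraction {poly F}}) (l : L) : Prop :=
  exists r1 r2 : L,
    let r1q := r1 ^+ #|F| in
    let r2q := r2 ^+ #|F| in
    let C := cross_ratio r1 r1q r2 r2q in
    [/\ degree_two r1 /\ degree_two r2,
        uniq [:: r1; r1q; r2; r2q],
        (forall a : option L, ramified (ratmap f) a <->
           a \in [:: Some r1; Some r1q; Some r2; Some r2q])
      & l = C + C^-1].

End OverFiniteField.

(* Main.v *)
Require Import Defs.
From HB Require Import structures.
From mathcomp Require Import all_boot all_order all_algebra all_field.
From mathcomp Require abelian.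
From mathcomp Require Import ring.
Set Implicit Arguments.
Unset Strict Implicit.
Unset Printing Implicit Defensive.
Import GRing.Theory.
Local Open Scope ring_scope.

(** As [theta f = theta g], there are Moebius maps over the algebraic closure
    with [g = psi \o f \o phi], and [phi] maps the four ramification points
    [y1, y1^q, y2, y2^q] of [g] to those [x1, x1^q, x2, x2^q] of [f].
    For any two ramification points [a], [b] of [f], with fibres [2 a + a'] and
    [2 b + b'], the involution exchanging [a] with [b] and [a'] with [b'] is
    absorbed by [f], so we may assume [phi y1 = x1]. As [lambda f = lambda g]
    differs from [1] and [5/2], the values of [lambda] for the three ways of
    pairing the four points are told apart, hence [phi (y1^q) = x1^q], and [phi]
    commutes with Frobenius on four points. So [phi] is defined over [F_q], and
    then so is [psi], by uniqueness.
    Finite ramification points are handled as the roots of the Wronskian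
    [P' Q - P Q'] of [f = P / Q], a quartic form in which four distinct roots
    exclude ramification at infinity. *)

(** * Rational functions as a field of fractions *)

Lemma fracB (K : fieldType) (x y z t : K) : y != 0 -> t != 0 ->
  x / y - z / t = (x * t - z * y) / (y * t).
Proof. by move=> y0 t0; rewrite -mulNr addf_div // mulNr. Qed.

Section LowestTerms.
Local Open Scope quotient_scope.
Variable K : fieldType.
Implicit Types (p d : {poly K}) (f : {fraction {poly K}}).

Lemma ratden_neq0 f : ratden f != 0.
Proof.
by rewrite /ratden dvdp_div_eq0 ?dvdp_gcdr // denom_ratioP.
Qed.

Lemma coprime_ratfun f : coprimep (ratnum f) (ratden f).
Proof.
by rewrite /ratnum /ratden coprimep_div_gcd // denom_ratioP orbT.
Qed.

Lemma fraction_repr f : f = ratfun (\n_(repr f)) (\d_(repr f)).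
Proof.
rewrite /ratfun; apply: (canRL (mulfK _)).
  by rewrite tofrac_eq0 denom_ratioP.
rewrite -{1}[f]reprK; set r := repr f.
have d0 := denom_ratioP r; unlock FracField.tofrac.
rewrite -[LHS]FracField.pi_mul; apply/eqP. rewrite piE /FracField.equivf.
by rewrite !numden_Ratio ?mulf_neq0 ?oner_eq0 // !mulr1 mulrC.
Qed.

Lemma ratfun_num_den f : ratfun (ratnum f) (ratden f) = f.
Proof.
set r := repr f; set g := gcdp (\n_r) (\d_r).
have g0 : g != 0 by rewrite gcdp_eq0 negb_and denom_ratioP orbT.
rewrite [RHS]fraction_repr -/r /ratfun.
rewrite -[X in _ = tofrac X / _](divpK (dvdp_gcdl _ (\d_r))).
rewrite -[X in _ = _ / tofrac X](divpK (dvdp_gcdr (\n_r) _)).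
by rewrite !rmorphM /= -mulf_div divff ?tofrac_eq0 // mulr1.
Qed.

Lemma eq_ratfun p d p' d' : d != 0 -> d' != 0 ->
  ratfun p d = ratfun p' d' -> p * d' = p' * d.
Proof.
move=> d0 d0' /eqP; rewrite /ratfun eqr_div ?tofrac_eq0 //.
by rewrite -!rmorphM tofrac_eq => /eqP.
Qed.

(** Since [ratden f] divides [ratnum f * d] and is coprime to [ratnum f], it divides [d]. The factor
    [u] then relates an arbitrary pair to the lowest terms. *)
Lemma ratfun_lowest p d : d != 0 ->
  exists2 u, u != 0 &
    p = u * ratnum (ratfun p d) /\ d = u * ratden (ratfun p d).
Proof.
move=> d0; set f := ratfun p d; have e0 := ratden_neq0 f.
have /(eq_ratfun e0 d0) E := ratfun_num_den f.
have /dvdpP[u Du] : ratden f %| d.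
  rewrite -(Gauss_dvdpr d (q := ratnum f)) ?E ?dvdp_mull //.
  by rewrite coprimep_sym coprime_ratfun.
have u0 : u != 0 by apply: contraNneq d0 => u0; rewrite Du u0 mul0r.
exists u => //; split=> //; apply: (mulIf e0).
by rewrite -E Du mulrCA mulrA.
Qed.

End LowestTerms.

Section Lift.
Variables (K M : fieldType) (j : {rmorphism {poly K} -> M}).

(* The proof of injectivity is an argument so that [fraclift] can be declared
   a ring morphism; so is the embedding in [frob] below. *)
Definition fraclift of (forall p, j p = 0 -> p = 0) :=
  fun f : {fraction {poly K}} => j (ratnum f) / j (ratden f).

Hypothesis j_inj : forall p, j p = 0 -> p = 0.

Let j_neq0 p : p != 0 -> j p != 0.
Proof. by apply: contraNneq => /j_inj ->. Qed.

(** The factor [u] relating [p / d] to its lowest terms cancels because [j u] is nonzero; any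
    representation may thus be used to compute the lift. *)
Lemma fraclift_ratfun p d : d != 0 -> fraclift j_inj (ratfun p d) = j p / j d.
Proof.
move=> d0; have [u u0 [Ep Ed]] := ratfun_lowest p d0; rewrite /fraclift.
by rewrite {3}Ep {4}Ed !rmorphM /= -mulf_div divff ?mul1r ?j_neq0.
Qed.

Lemma fraclift_is_zmod_morphism : zmod_morphism (fraclift j_inj).
Proof.
move=> f g; rewrite -[f]ratfun_num_den -[g]ratfun_num_den.
have f0 := ratden_neq0 f; have g0 := ratden_neq0 g.
rewrite !fraclift_ratfun // [X in fraclift _ X](_ : _ = ratfun
   (ratnum f * ratden g - ratnum g * ratden f) (ratden f * ratden g)).
  rewrite fraclift_ratfun ?mulf_neq0 // rmorphB !rmorphM.
  by rewrite fracB ?j_neq0.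
by rewrite /ratfun rmorphB !rmorphM /= fracB ?tofrac_eq0.
Qed.

Lemma fraclift_is_monoid_morphism : monoid_morphism (fraclift j_inj).
Proof.
split=> [|f g].
  have -> : 1 = ratfun 1 1 :> {fraction {poly K}}.
    by rewrite /ratfun rmorph1 divr1.
  by rewrite fraclift_ratfun ?oner_eq0 // rmorph1 divr1.
rewrite -[f]ratfun_num_den -[g]ratfun_num_den.
have f0 := ratden_neq0 f; have g0 := ratden_neq0 g.
rewrite !fraclift_ratfun // [X in fraclift _ X](_ : _ = ratfun
   (ratnum f * ratnum g) (ratden f * ratden g)).
  by rewrite fraclift_ratfun ?mulf_neq0 // !rmorphM mulf_div.
by rewrite /ratfun mulf_div !rmorphM.
Qed.

HB.instance Definition _ := GRing.isZmodMorphism.Build _ _ (fraclift j_inj)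
  fraclift_is_zmod_morphism.
HB.instance Definition _ := GRing.isMonoidMorphism.Build _ _ (fraclift j_inj)
  fraclift_is_monoid_morphism.

Lemma fraclift_tofrac p : fraclift j_inj (tofrac p) = j p.
Proof.
have -> : tofrac p = ratfun p 1 by rewrite /ratfun rmorph1 divr1.
by rewrite fraclift_ratfun ?oner_eq0 // rmorph1 divr1.
Qed.

End Lift.

Section Substitution.
Variable K : fieldType.
Local Notation E := {fraction {poly K}}.
Implicit Types (p d : {poly K}) (f g h : E).

Definition ratC : {rmorphism K -> E} := @tofrac {poly K} \o polyC.

(** This is [poly_at] packaged as a ring morphism, so that [ratcomp f h] is convertible to a lift to
    the field of fractions. *)
Definition polyAt h : {rmorphism {poly K} -> E} :=
  horner_eval h \o map_poly ratC.

End Substitution.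

(** * Moebius maps and substitution *)

Section MobiusField.
Variable M : fieldType.
Implicit Types a b c d x : M.

Definition mob a b c d x := (a * x + b) / (c * x + d).

(** Only the inner denominator has to be nonzero: where the outer one vanishes, both sides are 0 by
    the convention for inverses. *)
Lemma mob_comp a b c d a' b' c' d' x : c' * x + d' != 0 ->
  mob a b c d (mob a' b' c' d' x) =
  mob (a * a' + b * c') (a * b' + b * d') (c * a' + d * c') (c * b' + d * d') x.
Proof.
move=> nz; rewrite /mob.
have E u v : u * ((a' * x + b') / (c' * x + d')) + v =
   ((u * a' + v * c') * x + (u * b' + v * d')) / (c' * x + d') by field.
rewrite !E invf_div mulrA mulfVK //.
Qed.

Lemma mob_scale k a b c d x : k != 0 ->
  mob (k * a) (k * b) (k * c) (k * d) x = mob a b c d x.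
Proof. by move=> k0; rewrite /mob -!mulrA -!mulrDr -mulf_div divff ?mul1r. Qed.

Lemma mob_id x : mob 1 0 0 1 x = x.
Proof. by rewrite /mob mul1r addr0 mul0r add0r divr1. Qed.

End MobiusField.

Section Nonconstant.
Variable K : fieldType.
Local Notation E := {fraction {poly K}}.
Implicit Types (p q : {poly K}) (f g h : E) (a b c d : K).

Definition nonconst h := forall c, h <> ratcst c.

Definition transc h := forall p, polyAt h p = 0 -> p = 0.

Definition ratX : E := tofrac 'X.

Definition ratmob a b c d h := mob (ratC K a) (ratC K b) (ratC K c) (ratC K d) h.

Lemma ratC_eq0 a : (ratC K a == 0) = (a == 0).
Proof. exact: fmorph_eq0. Qed.

Lemma polyAtC h c : polyAt h c%:P = ratC K c.
Proof. by rewrite /= map_polyC /horner_eval hornerC. Qed.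

Lemma polyAtX h : polyAt h 'X = h.
Proof. by rewrite /= map_polyX /horner_eval hornerX. Qed.

Lemma polyAtCXn h c n : polyAt h (c%:P * 'X^n) = ratC K c * h ^+ n.
Proof.
rewrite (rmorphM (polyAt h)) (rmorphXn (polyAt h)); congr (_ * _ ^+ _).
  exact: polyAtC.
exact: polyAtX.
Qed.

Lemma polyAt_XsubC h c : polyAt h ('X - c%:P) = h - ratC K c.
Proof. by rewrite rmorphB; congr (_ - _); [exact: polyAtX | exact: polyAtC]. Qed.

Lemma ratmob_den_neq0 c d h : nonconst h -> (c != 0) || (d != 0) ->
  ratC K c * h + ratC K d != 0.
Proof.
move=> nh cd; apply/eqP => E0.
have [c0|c0] := eqVneq c 0.
  by move: cd E0; rewrite c0 eqxx rmorph0 mul0r add0r /= => d0 /eqP;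
     rewrite ratC_eq0 (negbTE d0).
apply: (nh (- d / c)); rewrite -[RHS]/(ratC K (- d / c)) rmorphM fmorphV.
apply: (canRL (mulfK _)); first by rewrite ratC_eq0.
by rewrite mulrC rmorphN; apply/eqP; rewrite -addr_eq0 E0.
Qed.

Lemma det_row_neq0 a b c d : a * d - b * c != 0 -> (c != 0) || (d != 0).
Proof.
apply: contraNT; rewrite negb_or !negbK => /andP[/eqP-> /eqP->].
by rewrite !mulr0 subrr.
Qed.

Lemma ratmob_comp a b c d a' b' c' d' h :
    nonconst h -> a' * d' - b' * c' != 0 ->
  ratmob a b c d (ratmob a' b' c' d' h) =
  ratmob (a * a' + b * c') (a * b' + b * d')
         (c * a' + d * c') (c * b' + d * d') h.
Proof.
move=> nh D; rewrite /ratmob mob_comp; last first.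
  exact: ratmob_den_neq0 (det_row_neq0 D).
by rewrite !rmorphD !rmorphM.
Qed.

Lemma ratmob_scale k a b c d h : k != 0 ->
  ratmob (k * a) (k * b) (k * c) (k * d) h = ratmob a b c d h.
Proof. by move=> k0; rewrite /ratmob !rmorphM mob_scale // ratC_eq0. Qed.

Lemma ratmob_id h : ratmob 1 0 0 1 h = h.
Proof. by rewrite /ratmob !rmorph1 !rmorph0 mob_id. Qed.

(** The adjugate matrix serves as inverse: the product is the determinant times the identity, and
    [ratmob_scale] removes the scalar. *)
Lemma ratmob_invl a b c d h : nonconst h -> a * d - b * c != 0 ->
  ratmob d (- b) (- c) a (ratmob a b c d h) = h.
Proof.
move=> nh D; rewrite ratmob_comp // -[RHS]ratmob_id.
rewrite -[RHS](ratmob_scale _ _ _ _ _ D); congr ratmob; ring.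
Qed.

Lemma ratmob_invr a b c d h : nonconst h -> a * d - b * c != 0 ->
  ratmob a b c d (ratmob d (- b) (- c) a h) = h.
Proof.
move=> nh D; rewrite ratmob_comp ?mulrNN 1?[d * a]mulrC // -[RHS]ratmob_id.
rewrite -[RHS](ratmob_scale _ _ _ _ _ D); congr ratmob; ring.
Qed.

Lemma ratmob_cst a b c d (e : K) :
  ratmob a b c d (ratcst e) = ratcst (mob a b c d e).
Proof.
by rewrite -[ratcst e]/(ratC K e) -[RHS]/(ratC K _) /ratmob /mob
  rmorphM fmorphV !rmorphD !rmorphM.
Qed.

Lemma nonconst_ratmob a b c d h : nonconst h -> a * d - b * c != 0 ->
  nonconst (ratmob a b c d h).
Proof.
move=> nh D e Ee; apply: (nh (mob d (- b) (- c) a e)).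
by rewrite -(ratmob_invl nh D) Ee ratmob_cst.
Qed.

Lemma nonconst_ratX : nonconst ratX.
Proof.
move=> c /eqP; rewrite tofrac_eq => /eqP /(congr1 (size : {poly K} -> nat)).
by rewrite size_polyX size_polyC; case: (c != 0).
Qed.

Lemma ratfun_ratmob a b c d :
  ratfun (a *: 'X + b%:P) (c *: 'X + d%:P) = ratmob a b c d ratX.
Proof. by rewrite /ratfun !rmorphD -!mul_polyC !rmorphM. Qed.

Section Subst.
Variables (h : E) (th : transc h).

Lemma ratcompE f : ratcomp f h = fraclift th f.
Proof. by []. Qed.

Lemma ratcompD : {morph (fun f => ratcomp f h) : f g / f + g}.
Proof. exact: (rmorphD (fraclift th)). Qed.

Lemma ratcompM : {morph (fun f => ratcomp f h) : f g / f * g}.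
Proof. exact: (rmorphM (fraclift th)). Qed.

Lemma ratcompV : {morph (fun f => ratcomp f h) : f / f^-1}.
Proof. exact: (fmorphV (fraclift th)). Qed.

Lemma ratcomp_inj : injective (fun f => ratcomp f h).
Proof. exact: (fmorph_inj (fraclift th)). Qed.

Lemma ratcomp_ratfun p q : q != 0 ->
  ratcomp (ratfun p q) h = polyAt h p / polyAt h q.
Proof. by move=> q0; rewrite ratcompE fraclift_ratfun. Qed.

Lemma ratcompC c : ratcomp (ratC K c) h = ratC K c.
Proof. by rewrite ratcompE fraclift_tofrac polyAtC. Qed.

Lemma ratcompX : ratcomp ratX h = h.
Proof. by rewrite ratcompE fraclift_tofrac polyAtX. Qed.

Lemma ratcomp_ratmob a b c d f :
  ratcomp (ratmob a b c d f) h = ratmob a b c d (ratcomp f h).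
Proof.
by rewrite /ratmob /mob ratcompM ratcompV !ratcompD !ratcompM !ratcompC.
Qed.

Lemma nonconst_ratcomp f : nonconst f -> nonconst (ratcomp f h).
Proof.
move=> nf c E; apply: (nf c); apply: ratcomp_inj.
by rewrite E -[ratcst c]/(ratC K c) ratcompC.
Qed.

Lemma ratcomp_polyAt p f : ratcomp (polyAt f p) h = polyAt (ratcomp f h) p.
Proof.
elim/poly_ind: p => [|p c IH].
  by rewrite !rmorph0 ratcompE rmorph0.
by rewrite !rmorphD !rmorphM !polyAtC !polyAtX ratcompD ratcompM IH ratcompC.
Qed.

End Subst.

Lemma ratcompA f g h : transc h -> transc g -> transc (ratcomp g h) ->
  ratcomp (ratcomp f g) h = ratcomp f (ratcomp g h).
Proof.
move=> th tg tgh; rewrite -[f]ratfun_num_den.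
have d0 := ratden_neq0 f.
rewrite (ratcomp_ratfun tg) // [RHS](ratcomp_ratfun tgh) //.
by rewrite (ratcompM th) (ratcompV th) !(ratcomp_polyAt th).
Qed.

Lemma ratcomp_id f : ratcomp f ratX = f.
Proof.
have tX p : polyAt ratX p = tofrac p.
  elim/poly_ind: p => [|p c IH]; first by rewrite !rmorph0.
  by rewrite !rmorphD !rmorphM IH polyAtX polyAtC.
have th : transc ratX.
  by move=> p /eqP; rewrite tX tofrac_eq0 => /eqP.
by rewrite ratcompE /fraclift !tX; exact: ratfun_num_den.
Qed.

End Nonconstant.

(** * Equivalence over an algebraically closed field *)

Section Closed.
Variable L : closedFieldType.
Local Notation E := {fraction {poly L}}.
Local Notation X := (ratX L).
Implicit Types (P Q p q : {poly L}) (f g h : E) (a b c d : L).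

(** Over an algebraically closed field a polynomial splits, and a linear factor ['X - z] vanishes at
    [h] only if [h] is the constant [z]. *)
Lemma nonconst_transc h : nonconst h -> transc h.
Proof.
move=> nh p; have [rs ->] := closed_field_poly_normal p.
rewrite -mul_polyC rmorphM polyAtC rmorph_prod => /eqP.
rewrite mulf_eq0 ratC_eq0 => /orP[/eqP->|]; first by rewrite polyC0 mul0r.
by rewrite prodf_seq_eq0 => /hasP[z _]; rewrite polyAt_XsubC subr_eq0 => /eqP /nh.
Qed.

Definition post_equiv f g := exists a b c d,
  a * d - b * c != 0 /\ g = ratmob a b c d f.

Lemma post_equiv_sym f g : nonconst f -> post_equiv f g -> post_equiv g f.
Proof.
move=> nf [a [b [c [d [D ->]]]]]; exists d, (- b), (- c), a.
by rewrite ratmob_invl // mulrNN [d * a]mulrC.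
Qed.

Lemma post_equiv_trans f g h :
  nonconst f -> post_equiv f g -> post_equiv g h -> post_equiv f h.
Proof.
move=> nf [a [b [c [d [D ->]]]]] [a' [b' [c' [d' [D' ->]]]]].
rewrite ratmob_comp //.
exists (a' * a + b' * c), (a' * b + b' * d), (c' * a + d' * c), (c' * b + d' * d).
split=> //; rewrite (_ : _ - _ = (a' * d' - b' * c') * (a * d - b * c)) ?mulf_neq0 //.
ring.
Qed.

Lemma post_equiv_nonconst f g : nonconst f -> post_equiv f g -> nonconst g.
Proof. by move=> nf [a [b [c [d [D ->]]]]]; exact: nonconst_ratmob. Qed.

Lemma post_equiv_ratcomp f g h :
  transc h -> post_equiv f g -> post_equiv (ratcomp f h) (ratcomp g h).
Proof.
move=> th [a [b [c [d [D ->]]]]]; exists a, b, c, d.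
by rewrite ratcomp_ratmob.
Qed.

(** Equivalence with the matrix of the inner map kept explicit, so that its action on points can be
    followed; the outer map stays hidden. *)
Definition moved a b c d f g :=
  a * d - b * c != 0 /\ post_equiv (ratcomp f (ratmob a b c d X)) g.

Lemma ratmobX_transc a b c d : a * d - b * c != 0 -> transc (ratmob a b c d X).
Proof.
by move=> D; apply/nonconst_transc/nonconst_ratmob => //; exact: nonconst_ratX.
Qed.

Lemma nonconst_ratcomp_mob a b c d f :
  a * d - b * c != 0 -> nonconst f -> nonconst (ratcomp f (ratmob a b c d X)).
Proof. by move=> D nf; apply: nonconst_ratcomp => //; exact: ratmobX_transc. Qed.

Lemma moved_nonconst a b c d f g :
  nonconst f -> moved a b c d f g -> nonconst g.
Proof.
by move=> nf [D]; apply: post_equiv_nonconst; exact: nonconst_ratcomp_mob.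
Qed.

Lemma moved_sym a b c d f g :
  nonconst f -> moved a b c d f g -> moved d (- b) (- c) a g f.
Proof.
move=> nf fg; have ng := moved_nonconst nf fg; case: fg => D fg.
have D' : d * a - - b * - c != 0 by rewrite mulrNN [d * a]mulrC.
split=> //; have th := ratmobX_transc D; have th' := ratmobX_transc D'.
apply: post_equiv_sym => //.
have := post_equiv_ratcomp th' fg; rewrite ratcompA //.
  by rewrite ratcomp_ratmob // ratcompX // ratmob_invr ?ratcomp_id //;
     exact: nonconst_ratX.
rewrite ratcomp_ratmob // ratcompX // ratmob_invr //; last exact: nonconst_ratX.
by apply: nonconst_transc; exact: nonconst_ratX.
Qed.

(** The inner map of the composite applies the second map first, which gives the product of the
    matrices in the order of the steps. *)
Lemma moved_trans a b c d a' b' c' d' f g h :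
  nonconst f -> moved a b c d f g -> moved a' b' c' d' g h ->
  moved (a * a' + b * c') (a * b' + b * d') (c * a' + d * c') (c * b' + d * d')
    f h.
Proof.
move=> nf [D fg] [D' gh].
have D'' : (a * a' + b * c') * (c * b' + d * d') -
    (a * b' + b * d') * (c * a' + d * c') != 0.
  rewrite (_ : _ - _ = (a * d - b * c) * (a' * d' - b' * c')) ?mulf_neq0 //.
  ring.
split=> //; have th := ratmobX_transc D; have th' := ratmobX_transc D'.
have th'' := ratmobX_transc D''.
have cE : ratcomp (ratmob a b c d X) (ratmob a' b' c' d' X) = ratmob
    (a * a' + b * c') (a * b' + b * d') (c * a' + d * c') (c * b' + d * d') X.
  by rewrite ratcomp_ratmob // ratcompX // ratmob_comp //; exact: nonconst_ratX.
have := post_equiv_ratcomp th' fg; rewrite ratcompA ?cE // => fg'.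
by apply: post_equiv_trans fg' gh; exact: nonconst_ratcomp_mob.
Qed.

Lemma equivalent_moved f g :
  nonconst f -> equivalent f g -> exists a b c d, moved a b c d f g.
Proof.
move=> nf [psi [phi [[a' [b' [c' [d' [D' ->]]]]] [a [b [c [d [D ->]]]]] ->]]].
exists a, b, c, d; split=> //; exists a', b', c', d'; split=> //.
rewrite !ratfun_ratmob.
have nt := nonconst_transc (nonconst_ratcomp_mob D nf).
by rewrite ratcomp_ratmob // ratcompX.
Qed.

(** The binary form of degree 3 obtained by homogenising [P], whatever the actual degree of [P];
    this treats the point at infinity like the others. *)
Definition hom3 P (u v : {poly L}) :=
  P`_0 *: v ^+ 3 + P`_1 *: (u * v ^+ 2) + P`_2 *: (u ^+ 2 * v) + P`_3 *: u ^+ 3.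

Lemma size4_poly P : (size P <= 4)%N ->
  P = (P`_0)%:P + (P`_1)%:P * 'X^1 + (P`_2)%:P * 'X^2 + (P`_3)%:P * 'X^3.
Proof.
move=> sP; apply/polyP => i; rewrite !coefD !coefCM coefC coefX !coefXn.
case: i => [|[|[|[|i]]]] /=; rewrite ?(mulr0, mulr1, addr0, add0r) //.
by rewrite nth_default // (leq_trans sP).
Qed.

Lemma hom3E (M : fieldType) (p0 p1 p2 p3 u v : M) : v != 0 ->
  p0 + p1 * (u / v) + p2 * (u / v) ^+ 2 + p3 * (u / v) ^+ 3 =
  (p0 * v ^+ 3 + p1 * (u * v ^+ 2) + p2 * (u ^+ 2 * v) + p3 * u ^+ 3) / v ^+ 3.
Proof. by move=> v0; field. Qed.

Lemma polyAt_hom3 P a b c d : (size P <= 4)%N -> (c != 0) || (d != 0) ->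
  polyAt (ratmob a b c d X) P =
  tofrac (hom3 P (a *: 'X + b%:P) (c *: 'X + d%:P)) /
    tofrac (c *: 'X + d%:P) ^+ 3.
Proof.
move=> sP cd; rewrite {1}(size4_poly sP) !(rmorphD (polyAt _)).
rewrite !polyAtCXn expr1 polyAtC -ratfun_ratmob /ratfun hom3E.
  by rewrite /hom3 -!(mul_polyC _`_ _) !(tofracD, tofracXn, tofracM).
have := ratmob_den_neq0 (@nonconst_ratX L) cd.
by rewrite rmorphD -mul_polyC rmorphM.
Qed.

(** The numerator of the derivative of [P / Q]. *)
Definition wronsk P Q := P^`() * Q - P * Q^`().

Lemma wronsk_comb P Q a b c d :
  wronsk (a *: P + b *: Q) (c *: P + d *: Q) = (a * d - b * c) *: wronsk P Q.
Proof.
rewrite /wronsk !derivD !derivZ -!mul_polyC rmorphB !rmorphM /=.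
move: a%:P b%:P c%:P d%:P P^`() Q^`() => *; ring.
Qed.

Lemma wronskMl u P Q : wronsk (u * P) (u * Q) = u ^+ 2 * wronsk P Q.
Proof. by rewrite /wronsk !derivM; move: u^`() P^`() Q^`() => *; ring. Qed.

End Closed.

(** * The Wronskian *)

(** Here [u'] and [v'] play the role of derivatives. By Euler's relation for cubic forms, the last
    factor is one third of their Jacobian determinant; as its coefficients are integral, the
    identity also holds in characteristic 3. *)
Lemma wronsk_form_identity (R : comNzRingType)
    (p0 p1 p2 p3 q0 q1 q2 q3 u v u' v' : R) :
  let F p0 p1 p2 p3 :=
    p0 * v ^+ 3 + p1 * (u * v ^+ 2) + p2 * (u ^+ 2 * v) + p3 * u ^+ 3 in
  let dF p0 p1 p2 p3 :=
    (p1 * v ^+ 2 + 2%:R * p2 * (u * v) + 3%:R * p3 * u ^+ 2) * u' +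
    (3%:R * p0 * v ^+ 2 + 2%:R * p1 * (u * v) + p2 * u ^+ 2) * v' in
  dF p0 p1 p2 p3 * F q0 q1 q2 q3 - F p0 p1 p2 p3 * dF q0 q1 q2 q3 =
  (u' * v - u * v') *
    ((p1 * q0 - p0 * q1) * v ^+ 4 +
     2%:R * (p2 * q0 - p0 * q2) * (u * v ^+ 3) +
     (3%:R * (p3 * q0 - p0 * q3) + (p2 * q1 - p1 * q2)) * (u ^+ 2 * v ^+ 2) +
     2%:R * (p3 * q1 - p1 * q3) * (u ^+ 3 * v) +
     (p3 * q2 - p2 * q3) * u ^+ 4).
Proof. by move=> F dF; rewrite /F /dF; ring. Qed.

Section Wronskian.
Variable L : closedFieldType.
Implicit Types (P Q : {poly L}) (a b c d : L).

Lemma deriv_hom3 P (u v : {poly L}) :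
  (hom3 P u v)^`() =
  ((P`_1)%:P * v ^+ 2 + 2%:R * (P`_2)%:P * (u * v) + 3%:R * (P`_3)%:P * u ^+ 2)
    * u^`() +
  (3%:R * (P`_0)%:P * v ^+ 2 + 2%:R * (P`_1)%:P * (u * v) + (P`_2)%:P * u ^+ 2)
    * v^`().
Proof.
rewrite /hom3 !derivD !derivZ !(deriv_exp, derivM) -!mul_polyC /=.
move: (P`_0)%:P (P`_1)%:P (P`_2)%:P (P`_3)%:P u^`() v^`() => *; ring.
Qed.

Definition form4 (w0 w1 w2 w3 w4 : L) (u v : {poly L}) : {poly L} :=
  w0 *: v ^+ 4 + w1 *: (u * v ^+ 3) + w2 *: (u ^+ 2 * v ^+ 2) +
  w3 *: (u ^+ 3 * v) + w4 *: u ^+ 4.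

Lemma hom3_X1 P : (size P <= 4)%N -> hom3 P 'X 1 = P.
Proof.
move=> sP; rewrite [RHS](size4_poly sP) /hom3 -!mul_polyC !expr1n !mulr1.
by rewrite expr1.
Qed.

(** The same quartic form gives the Wronskian before and after a substitution, so the roots of the
    new Wronskian are carried to zeros of the old form. *)
Lemma wronsk_form P Q : (size P <= 4)%N -> (size Q <= 4)%N ->
  exists w0 w1 w2 w3 w4, [/\ wronsk P Q = form4 w0 w1 w2 w3 w4 'X 1 &
    forall u v : {poly L}, wronsk (hom3 P u v) (hom3 Q u v) =
      (u^`() * v - u * v^`()) * form4 w0 w1 w2 w3 w4 u v].
Proof.
move=> sP sQ.
exists (P`_1 * Q`_0 - P`_0 * Q`_1), (2%:R * (P`_2 * Q`_0 - P`_0 * Q`_2)),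
 (3%:R * (P`_3 * Q`_0 - P`_0 * Q`_3) + (P`_2 * Q`_1 - P`_1 * Q`_2)),
 (2%:R * (P`_3 * Q`_1 - P`_1 * Q`_3)), (P`_3 * Q`_2 - P`_2 * Q`_3).
set w0 := P`_1 * _ - _; set w1 := 2%:R * _; set w2 := _ + (P`_2 * _ - _).
set w3 := 2%:R * _; set w4 := P`_3 * _ - _.
suff H u v : wronsk (hom3 P u v) (hom3 Q u v) =
      (u^`() * v - u * v^`()) * form4 w0 w1 w2 w3 w4 u v.
  split=> //; rewrite -[in LHS](hom3_X1 sP) -[in LHS](hom3_X1 sQ) H.
  by rewrite derivX derivC mulr0 subr0 !mul1r.
rewrite /wronsk !deriv_hom3 /hom3 /form4 -!mul_polyC.
apply: (etrans (wronsk_form_identity _ _ _ _ _ _ _ _ _ _ _ _)).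
by rewrite !(polyCD, polyCN, polyCM, polyC_natr).
Qed.

Lemma horner_form4 w0 w1 w2 w3 w4 u v x :
  (form4 w0 w1 w2 w3 w4 u v).[x] =
  w0 * v.[x] ^+ 4 + w1 * (u.[x] * v.[x] ^+ 3) + w2 * (u.[x] ^+ 2 * v.[x] ^+ 2) +
  w3 * (u.[x] ^+ 3 * v.[x]) + w4 * u.[x] ^+ 4.
Proof. by rewrite /form4 !(horner_exp, hornerD, hornerZ, hornerM). Qed.

(** A nonzero [w4] means that the quartic form does not vanish at infinity, the point with
    [v = 0]. *)
Lemma form4_lead w0 w1 w2 w3 w4 : size (form4 w0 w1 w2 w3 w4 'X 1) = 5 -> w4 != 0.
Proof.
move=> s5; have : lead_coef (form4 w0 w1 w2 w3 w4 'X 1) != 0.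
  by rewrite lead_coef_eq0 -size_poly_eq0 s5.
rewrite /lead_coef s5 /form4 !expr1n !mulr1 !coefD !coefZ coef1 !coefXn coefX /=.
by rewrite !mulr0 !add0r mulr1.
Qed.

End Wronskian.

(** * Transport of the roots of the Wronskian by Moebius maps *)

Section Moving.
Variable L : closedFieldType.
Implicit Types (P Q : {poly L}) (a b c d : L) (f g : {fraction {poly L}}).

Definition ramW f := wronsk (ratnum f) (ratden f).

Definition cubic f := exists P Q,
  [/\ (size P <= 4)%N, (size Q <= 4)%N, Q != 0 & f = ratfun P Q].

Lemma size_hom3 P (u v : {poly L}) : (size u <= 2)%N -> (size v <= 2)%N ->
  (size (hom3 P u v) <= 4)%N.
Proof.
move=> su sv.
have sM (p q : {poly L}) m n :
    (size p <= m.+1)%N -> (size q <= n.+1)%N -> (size (p * q)%R <= (m + n).+1)%N.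
  move=> sp sq; apply: leq_trans (size_polyMleq _ _) _.
  by rewrite -subn1 leq_subLR add1n -addnS -addSn leq_add.
have s2 (p : {poly L}) : (size p <= 2)%N -> (size (p ^+ 2)%R <= 3)%N.
  by move=> sp; rewrite expr2; exact: (sM _ _ 1 1).
have s3 (p : {poly L}) : (size p <= 2)%N -> (size (p ^+ 3)%R <= 4)%N.
  by move=> sp; rewrite exprS; apply: (sM _ _ 1 2) => //; exact: s2.
have s12 (p q : {poly L}) : (size p <= 2)%N -> (size q <= 2)%N ->
    (size (p * q ^+ 2)%R <= 4)%N.
  by move=> sp sq; apply: (sM _ _ 1 2) => //; exact: s2.
have sD (p q : {poly L}) : (size p <= 4)%N -> (size q <= 4)%N ->
    (size (p + q)%R <= 4)%N.
  by move=> sp sq; rewrite (leq_trans (size_polyD _ _)) // geq_max sp.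
have sZ k (p : {poly L}) : (size p <= 4)%N -> (size (k *: p)%R <= 4)%N.
  by apply: leq_trans; exact: size_scale_leq.
by rewrite /hom3 !sD ?sZ ?s3 ?s12 // mulrC s12.
Qed.

Lemma size_mobius a b : (size (a *: 'X + b%:P)%R <= 2)%N.
Proof.
by rewrite -mul_polyC size_MXaddC size_polyC; case: ifP => //; case: (a != 0).
Qed.

Lemma moved_ratfun a b c d P Q f g :
    nonconst f -> f = ratfun P Q -> Q != 0 ->
    (size P <= 4)%N -> (size Q <= 4)%N -> moved a b c d f g ->
  let u := a *: 'X + b%:P in let v := c *: 'X + d%:P in
  exists A B C D, let Q1 := C *: hom3 P u v + D *: hom3 Q u v in
   [/\ A * D - B * C != 0, Q1 != 0 &
       g = ratfun (A *: hom3 P u v + B *: hom3 Q u v) Q1].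
Proof.
move=> nf Ef Q0 sP sQ [D0 [A [B [C [D [D1 Eg]]]]]] u v.
have nh := nonconst_ratcomp_mob D0 nf; have th := ratmobX_transc D0.
have v0 : v != 0.
  have := ratmob_den_neq0 (@nonconst_ratX L) (det_row_neq0 D0).
  rewrite -[ratX L]/(tofrac 'X) -[ratC L c]/(tofrac c%:P) -tofracM mul_polyC.
  by rewrite -[ratC L d]/(tofrac d%:P) -tofracD tofrac_eq0.
have cd := det_row_neq0 D0.
(* Otherwise [Q] would vanish at the inner map, which is transcendental. *)
have hQ0 : hom3 Q u v != 0.
  apply: contraNneq Q0 => hQ0; apply/eqP/th.
  by rewrite polyAt_hom3 // -/u -/v hQ0 rmorph0 mul0r.
have Eh : ratcomp f (ratmob a b c d (ratX L)) = ratfun (hom3 P u v) (hom3 Q u v).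
  rewrite Ef ratcomp_ratfun // !polyAt_hom3 // -/u -/v /ratfun.
  by rewrite invf_div mulrA mulfVK // expf_neq0 // tofrac_eq0.
have EM x y : tofrac (x *: hom3 P u v + y *: hom3 Q u v) =
    (ratC L x * ratfun (hom3 P u v) (hom3 Q u v) + ratC L y) *
      tofrac (hom3 Q u v).
  rewrite tofracD -!mul_polyC !tofracM mulrDl /ratfun -mulrA.
  by rewrite divfK // tofrac_eq0.
have := ratmob_den_neq0 nh (det_row_neq0 D1); rewrite Eh => CD0.
exists A, B, C, D; split; first exact: D1.
  rewrite -tofrac_eq0 (EM C D); apply: mulf_neq0; first exact: CD0.
  by rewrite tofrac_eq0.
rewrite Eg Eh [RHS]/ratfun !EM -mulf_div divff ?mulr1; first reflexivity.
by rewrite tofrac_eq0.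
Qed.

Lemma cubic_moved a b c d f g :
  nonconst f -> cubic f -> moved a b c d f g -> cubic g.
Proof.
move=> nf [P [Q [sP sQ Q0 Ef]]] /(moved_ratfun nf Ef Q0 sP sQ) /=.
move=> [A [B [C [D [_ Q10 Eg]]]]].
have sh (x y : L) (p q : {poly L}) : (size p <= 4)%N -> (size q <= 4)%N ->
    (size (x *: p + y *: q)%R <= 4)%N.
  move=> sp sq; rewrite (leq_trans (size_polyD _ _)) // geq_max.
  by rewrite !(leq_trans (size_scale_leq _ _)).
by do 2!eexists; split; last exact: Eg; rewrite // sh // size_hom3 ?size_mobius.
Qed.

Lemma cubic_lowest f : cubic f ->
  (size (ratnum f) <= 4)%N /\ (size (ratden f) <= 4)%N.
Proof.
move=> [P [Q [sP sQ Q0 ->]]]; have [w w0 [Ep Eq]] := ratfun_lowest P Q0.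
set p := ratnum _ in Ep *; set q := ratden _ in Eq *.
have s (z : {poly L}) : (size z <= size (w * z)%R)%N.
  have [->|z0] := eqVneq z 0; first by rewrite size_poly0.
  by rewrite dvdp_leq ?mulf_neq0 ?dvdp_mull.
by rewrite (leq_trans (s p)) -?Ep // (leq_trans (s q)) -?Eq.
Qed.

(** Up to a square factor from the reduction to lowest terms, the Wronskian of [g] is the product of
    both determinants with the quartic form of [f] at [(a x + b, c x + d)]. The form thus vanishes
    at this point, and degree 4 excludes infinity. *)
Lemma moved_root a b c d f g x :
    nonconst f -> cubic f -> size (ramW f) = 5 -> moved a b c d f g ->
    root (ramW g) x ->
  c * x + d != 0 /\ root (ramW f) ((a * x + b) / (c * x + d)).
Proof.
move=> nf cf s5 fg /rootP Wx; have [sP sQ] := cubic_lowest cf.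
have D0 := fg.1; have := moved_ratfun nf (esym (ratfun_num_den f))
  (ratden_neq0 f) sP sQ fg.
move: Wx s5; rewrite /ramW.
set P := ratnum f in sP *; set Q := ratden f in sQ *.
move=> Wx s5 [A [B [C [D [D1 Q10 Eg]]]]].
have [w0 [w1 [w2 [w3 [w4 [EW /(_ (a *: 'X + b%:P) (c *: 'X + d%:P)) Eh]]]]]] :=
  wronsk_form sP sQ.
rewrite EW in s5 *; have w40 := form4_lead s5.
have [k k0 [Ep Eq]] := ratfun_lowest
  (A *: hom3 P (a *: 'X + b%:P) (c *: 'X + d%:P) +
   B *: hom3 Q (a *: 'X + b%:P) (c *: 'X + d%:P)) Q10.
move: Ep Eq; rewrite -Eg => Ep Eq.
have := wronskMl k (ratnum g) (ratden g); rewrite -Ep -Eq wronsk_comb Eh.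
move=> /(congr1 (fun p : {poly L} => p.[x])); rewrite hornerM Wx mulr0 hornerZ.
rewrite hornerM !derivD !derivZ !derivX !derivC !addr0.
rewrite !alg_polyC horner_form4.
rewrite !(hornerD, hornerN, hornerM, hornerZ, hornerX, hornerC) => /eqP.
rewrite mulf_eq0 (negPf D1) /=.
rewrite mulf_eq0 (_ : _ - _ = a * d - b * c); last by ring.
rewrite (negPf D0) /= => /eqP H.
(* If [c x + d] were 0, only the term in [w4] would survive, so [a x + b] would be 0 too, which the
   determinant forbids. *)
have v0 : c * x + d != 0.
  apply/eqP => v0; move: H; rewrite v0 !expr0n /= !(mulr0, add0r) => /eqP.
  rewrite mulf_eq0 (negPf w40) expf_eq0 /= => /eqP u0.
  have /eqP : (a * d - b * c) * x = 0.
    rewrite (_ : _ * x = d * (a * x + b) - b * (c * x + d)); last by ring.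
    by rewrite u0 v0 !mulr0 subr0.
  have /eqP : a * d - b * c = 0.
    rewrite (_ : _ - _ = a * (c * x + d) - c * (a * x + b)); last by ring.
    by rewrite u0 v0 !mulr0 subr0.
  by rewrite (negPf D0).
split=> //; apply/rootP; rewrite horner_form4 hornerX hornerC.
set u := a * x + b in H *; set v := c * x + d in H v0 *.
apply: (mulIf (expf_neq0 4 v0)); rewrite mul0r -H; field.
exact: v0.
Qed.

End Moving.

(** * Involutions swapping ramification points *)

Lemma double_root (K : fieldType) (p : {poly K}) a :
  root p a -> root p^`() a -> exists s, p = s * ('X - a%:P) ^+ 2.
Proof.
move=> /factor_theorem[r ->]; rewrite derivM derivXsubC mulr1.
rewrite /root hornerD hornerM hornerXsubC subrr mulr0 add0r.
by move=> /factor_theorem[s ->]; exists s; rewrite expr2 mulrA.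
Qed.

Lemma size2_poly (K : fieldType) (p : {poly K}) : (size p <= 2)%N ->
  p = p`_1 *: 'X + (p`_0)%:P.
Proof.
move=> sp; apply/polyP => i; rewrite coefD coefZ coefX coefC.
case: i => [|[|i]] /=; rewrite ?(mulr0, mulr1, addr0, add0r) //.
by rewrite nth_default // (leq_trans sp).
Qed.

(** The trace-zero matrix with entries [alpha], [beta], [gamma], [- alpha] exchanges [a] with [b]
    and [- n / m] with [- l / k]. Hence each linear factor at [y] is a constant times the factor at
    [x] belonging to the exchanged point, over a common denominator that cancels in the quotient.
    Allowing [m = 0] or [k = 0] covers residual points at infinity. *)
Lemma swap_form (M : fieldType) (a b m n k l x : M)
    (alpha := a * b * m * k - n * l)
    (beta := a * b * (n * k + l * m) + (a + b) * (n * l))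
    (gamma := (a + b) * (m * k) + n * k + l * m)
    (y := (alpha * x + beta) / (gamma * x - alpha)) :
    gamma * x - alpha != 0 ->
    m * a + n != 0 -> k * a + l != 0 -> m * b + n != 0 -> k * b + l != 0 ->
    x - a != 0 -> m * x + n != 0 -> x - b != 0 -> k * x + l != 0 ->
  ((y - a) ^+ 2 * (m * y + n)) / ((y - b) ^+ 2 * (k * y + l)) =
  ((m * a + n) ^+ 3 * (k * a + l)) / ((m * b + n) * (k * b + l) ^+ 3) *
  (((x - a) ^+ 2 * (m * x + n)) / ((x - b) ^+ 2 * (k * x + l)))^-1.
Proof.
move=> v0 ma ka mb kb xa mx xb kx.
have -> : y - a = - ((m * a + n) * (k * a + l)) * (x - b) / (gamma * x - alpha).
  by rewrite /y /gamma /alpha /beta in v0 *; field.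
have -> : y - b = - ((m * b + n) * (k * b + l)) * (x - a) / (gamma * x - alpha).
  by rewrite /y /gamma /alpha /beta in v0 *; field.
have -> : m * y + n = (m * a + n) * (m * b + n) * (k * x + l) / (gamma * x - alpha).
  by rewrite /y /gamma /alpha /beta in v0 *; field.
have -> : k * y + l = (k * a + l) * (k * b + l) * (m * x + n) / (gamma * x - alpha).
  by rewrite /y /gamma /alpha /beta in v0 *; field.
move: v0; set v := gamma * x - alpha => v0.
move: ma ka mb kb xa mx xb kx.
move: (m * a + n) (k * a + l) (m * b + n) (k * b + l) (x - a) (m * x + n) (x - b)
  (k * x + l) v v0 => A B C D E F G H v v0 *; field.
by rewrite oppr_eq0 mulf_neq0 //; repeat (apply/andP; split).
Qed.

Section Swap.
Variable L : closedFieldType.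
Implicit Types (P Q : {poly L}) (a b c d : L) (f g : {fraction {poly L}}).

Lemma ratnum_ratden_root f a : (ratnum f).[a] = 0 -> (ratden f).[a] != 0.
Proof. by move=> /rootP; apply: coprimep_root; exact: coprime_ratfun. Qed.

(* The fibre through a simple ramification point [a] consists of [a], counted
   twice, and of a point distinct from [a]. *)
Lemma ram_fibre f a (P := ratnum f) (Q := ratden f) :
    (size P <= 4)%N -> (size Q <= 4)%N ->
    root (ramW f) a -> ~~ (('X - a%:P) ^+ 2 %| ramW f) ->
  exists m n, Q.[a] *: P - P.[a] *: Q =
    ('X - a%:P) ^+ 2 * (m *: 'X + n%:P) /\ m * a + n != 0.
Proof.
move=> sP sQ Wa Wa2.
(* The combination vanishes at [a] by its form, and its derivative at [a] is the value of the
   Wronskian there. *)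
have [s Es] : exists s, Q.[a] *: P - P.[a] *: Q = s * ('X - a%:P) ^+ 2.
  apply: double_root; apply/rootP.
    by rewrite hornerD hornerN !hornerZ mulrC subrr.
  move: Wa => /rootP; rewrite /ramW /wronsk !(hornerD, hornerN, hornerM).
  rewrite derivD derivN !derivZ !(hornerD, hornerN, hornerZ) => W0.
  by rewrite -/P -/Q in W0; rewrite -W0 [Q.[a] * _]mulrC.
have s2 : (size s <= 2)%N.
  have [->|s0] := eqVneq s 0; first by rewrite size_poly0.
  have : (size (Q.[a] *: P - P.[a] *: Q)%R <= 4)%N.
    rewrite (leq_trans (size_polyD _ _)) // geq_max size_polyN.
    by rewrite !(leq_trans (size_scale_leq _ _)).
  rewrite Es size_Mmonic ?monic_exp ?monicXsubC // size_exp_XsubC.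
  by rewrite addn3 /= !ltnS.
exists s`_1, s`_0; rewrite -size2_poly // mulrC; split=> //.
(* A triple zero of the combination at [a] would give the Wronskian a double zero there. *)
apply: contra Wa2 => /eqP sa.
have {}sa : root s a.
  by rewrite (size2_poly s2) /root hornerD hornerZ hornerX hornerC sa.
move: sa => /factor_theorem[t Et].
have dW R : ('X - a%:P) ^+ 2 %| wronsk (Q.[a] *: P - P.[a] *: Q) R.
  rewrite Es Et -mulrA -exprS /wronsk derivM deriv_exp derivXsubC mul1r /=.
  rewrite -mulr_natr.
  set D := 'X - _; apply/dvdpP.
  exists ((t^`() * D + t * 3%:R) * R - t * D * R^`()); rewrite [D ^+ 3]exprS; ring.
(* The Wronskian of the combination with [P] or with [Q] is a constant multiple of [ramW f];
   coprimality makes one of the two constants nonzero. *)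
have [Q0|Q0] := eqVneq Q.[a] 0.
  have P0 : P.[a] != 0.
    by apply/eqP => /ratnum_ratden_root; rewrite -/Q Q0 eqxx.
  have := dW P; rewrite Q0 scale0r sub0r.
  rewrite (_ : wronsk _ _ = P.[a] *: ramW f) ?dvdpZr //.
  rewrite /wronsk /ramW /wronsk -/P -/Q derivN derivZ -!mul_polyC.
  move: (P.[a])%:P Q^`() P^`() => *; ring.
have := dW Q; rewrite (_ : wronsk _ _ = Q.[a] *: ramW f) ?dvdpZr //.
rewrite /wronsk /ramW /wronsk -/P -/Q derivD derivN !derivZ -!mul_polyC.
move: (P.[a])%:P (Q.[a])%:P Q^`() P^`() => *; ring.
Qed.

(** Two ramification points have different values: a common fibre would contain both of them doubly,
    so the linear cofactor [m X + n] would vanish to order 2 at [b] and hence be 0. *)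
Lemma ram_fibres_indep f a b (P := ratnum f) (Q := ratden f) :
    (size P <= 4)%N -> (size Q <= 4)%N -> a != b ->
    root (ramW f) a -> ~~ (('X - a%:P) ^+ 2 %| ramW f) -> root (ramW f) b ->
  Q.[a] * P.[b] - P.[a] * Q.[b] != 0.
Proof.
move=> sP sQ ab Wa Wa2 /rootP Wb.
have [m [n [E man]]] := ram_fibre sP sQ Wa Wa2; rewrite -/P -/Q in E.
apply: contra man => /eqP D.
have ba : b - a != 0 by rewrite subr_eq0 eq_sym.
have mb : m * b + n = 0.
  have /eqP : (b - a) ^+ 2 * (m * b + n) = 0.
    rewrite -D; have /(congr1 (fun p : {poly L} => p.[b])) := E.
    rewrite !(hornerD, hornerN, horner_exp, hornerM, hornerZ, hornerX, hornerC).
    by move=> ->.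
  by rewrite mulf_eq0 expf_eq0 (negPf ba) => /eqP.
have Db : Q.[a] * P^`().[b] - P.[a] * Q^`().[b] = 0.
  move: Wb; rewrite /ramW /wronsk -/P -/Q !(hornerD, hornerN, hornerM) => Wb.
  have [Pb|Pb] := eqVneq P.[b] 0.
    have Qb : Q.[b] != 0 by exact: ratnum_ratden_root.
    move: D; rewrite Pb mulr0 sub0r => /eqP; rewrite oppr_eq0 mulf_eq0 (negPf Qb).
    rewrite orbF => /eqP Pa; move: Wb; rewrite Pb mul0r subr0 => /eqP.
    rewrite mulf_eq0 (negPf Qb) orbF => /eqP ->.
    by rewrite Pa mulr0 mul0r subr0.
  apply: (mulIf Pb); rewrite mul0r -(mulr0 P.[a]) -Wb.
  move/eqP: D; rewrite subr_eq0 => /eqP D.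
  transitivity (Q.[a] * P.[b] * P^`().[b] - P.[a] * P.[b] * Q^`().[b]); first by ring.
  by rewrite D; ring.
have m0 : m = 0.
  have /eqP : (b - a) ^+ 2 * m = 0.
    have /(congr1 (fun p : {poly L} => p^`().[b])) := E.
    rewrite derivD derivN !derivZ derivM deriv_exp derivXsubC derivD derivZ.
    rewrite derivX derivC addr0 alg_polyC.
    rewrite !(hornerD, hornerN, horner_exp, hornerM, hornerZ, hornerX, hornerC).
    by rewrite Db mb mulr0 add0r => <-.
  by rewrite mulf_eq0 expf_eq0 (negPf ba) => /eqP.
by move: mb; rewrite m0 !mul0r => ->.
Qed.

Lemma tofrac_linear_neq0 m n x : m * x + n != 0 ->
  ratC L m * ratX L + ratC L n != 0.
Proof.
move=> mx; apply: ratmob_den_neq0 (@nonconst_ratX L) _.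
by apply: contraNT mx; rewrite negb_or !negbK => /andP[/eqP-> /eqP->];
   rewrite mul0r addr0.
Qed.

(* The involution exchanging [a] with [b], and the residual points [- n / m]
   and [- l / k] of their fibres, exchanges zeros and poles of the function
   [f1] post-equivalent to [f] whose divisor is the difference of these fibres;
   so it turns [f1] into a multiple of [1 / f1]. *)
Lemma ram_swap f a b :
    nonconst f -> cubic f -> a != b ->
    root (ramW f) a -> ~~ (('X - a%:P) ^+ 2 %| ramW f) ->
    root (ramW f) b -> ~~ (('X - b%:P) ^+ 2 %| ramW f) ->
  exists al be ga de, [/\ moved al be ga de f f, ga * a + de != 0 &
    al * a + be = b * (ga * a + de)].
Proof.
move=> nf /cubic_lowest[sP sQ] ab Wa Wa2 Wb Wb2.
have [m [n [Ea ma]]] := ram_fibre sP sQ Wa Wa2.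
have [k [l [Eb kb]]] := ram_fibre sP sQ Wb Wb2.
have D := ram_fibres_indep sP sQ ab Wa Wa2 Wb.
have ba : b - a != 0 by rewrite subr_eq0 eq_sym.
(* If [b] were the residual point of the fibre of [a], both points would have the same value. *)
have mb : m * b + n != 0.
  apply: contra D => /eqP mb; apply/eqP.
  have /(congr1 (fun p : {poly L} => p.[b])) := Ea.
  rewrite !(hornerD, hornerN, horner_exp, hornerM, hornerZ, hornerX, hornerC).
  by rewrite mb mulr0.
have ka : k * a + l != 0.
  apply: contra D => /eqP ka; apply/eqP.
  have /(congr1 (fun p : {poly L} => p.[a])) := Eb.
  rewrite !(hornerD, hornerN, horner_exp, hornerM, hornerZ, hornerX, hornerC).
  rewrite ka mulr0 => /eqP; rewrite subr_eq0 => /eqP E.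
  by rewrite [RHS]/= mulrC -E; ring.
set al := a * b * m * k - n * l.
set be := a * b * (n * k + l * m) + (a + b) * (n * l).
set ga := (a + b) * (m * k) + n * k + l * m.
have det : al * - al - be * ga != 0.
  rewrite (_ : _ - _ = - ((m * a + n) * (m * b + n) * (k * a + l) * (k * b + l))).
    by rewrite oppr_eq0 !mulf_neq0.
  by rewrite /al /be /ga; ring.
exists al, be, ga, (- al); split; last 2 first.
- rewrite (_ : _ + _ = (m * a + n) * (k * a + l)) ?mulf_neq0 //.
  by rewrite /al /ga; ring.
- by rewrite /al /be /ga; ring.
split=> //; have th := ratmobX_transc det.
set phi := ratmob al be ga (- al) (ratX L) in th *.
set P := ratnum f in sP Ea Eb D *; set Q := ratden f in sQ Ea Eb D *.
(* [F1] sends the value of [f] at [a] to 0 and its value at [b] to infinity, so that the two fibres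
   become the zeros and the poles. *)
pose F1 := ratmob Q.[a] (- P.[a]) Q.[b] (- P.[b]).
have D1 : Q.[a] * - P.[b] - - P.[a] * Q.[b] != 0.
  rewrite (_ : _ - _ = - (Q.[a] * P.[b] - P.[a] * Q.[b])) ?oppr_eq0 //; ring.
pose lin (x y : L) z := ratC L x * z + ratC L y.
pose form a' m' n' (z : {fraction {poly L}}) :=
  (z - ratC L a') ^+ 2 * lin m' n' z.
have formE a' m' n' : tofrac (('X - a'%:P) ^+ 2 * (m' *: 'X + n'%:P)) =
    form a' m' n' (ratX L).
  by rewrite tofracM tofracXn tofracB tofracD -mul_polyC tofracM.
have F1E : F1 f = form a m n (ratX L) / form b k l (ratX L).
  rewrite -!formE -Ea -Eb /F1 /ratmob /mob.
  have EP (x y : L) : ratC L x * f + ratC L (- y) =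
      tofrac (x *: P - y *: Q) / tofrac Q.
    rewrite tofracB -!mul_polyC !tofracM mulrBl mulfK ?tofrac_eq0 ?ratden_neq0 //.
    by rewrite -{1}[f]ratfun_num_den -mulrA rmorphN.
  by rewrite !EP invf_div mulrA divfK // tofrac_eq0 ratden_neq0.
pose ka' := ((m * a + n) ^+ 3 * (k * a + l)) / ((m * b + n) * (k * b + l) ^+ 3).
have ka'0 : ka' != 0.
  by rewrite /ka' !(mulf_neq0, invr_neq0, expf_neq0).
have F1phi : F1 (ratcomp f phi) = ratcomp (F1 f) phi.
  by rewrite /F1 ratcomp_ratmob.
have linphi x y : ratcomp (lin x y (ratX L)) phi = lin x y phi.
  by rewrite (ratcompD th) (ratcompM th) !ratcompC // ratcompX.
have subphi x : ratcomp (ratX L - ratC L x) phi = phi - ratC L x.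
  by rewrite -rmorphN (ratcompD th) ratcompX // ratcompC // rmorphN.
have formphi a' m' n' : ratcomp (form a' m' n' (ratX L)) phi = form a' m' n' phi.
  by rewrite /form (ratcompM th) linphi expr2 (ratcompM th) subphi -expr2.
have sw : F1 (ratcomp f phi) = ratC L ka' / F1 f.
  rewrite F1phi F1E (ratcompM th) (ratcompV th) !formphi.
  rewrite /form /lin /phi /ratmob /mob.
  have Eal : ratC L al = ratC L a * ratC L b * ratC L m * ratC L k - ratC L n * ratC L l.
    by rewrite !(rmorphB, rmorphM).
  have Ebe : ratC L be = ratC L a * ratC L b * (ratC L n * ratC L k + ratC L l * ratC L m)
      + (ratC L a + ratC L b) * (ratC L n * ratC L l).
    by rewrite !(rmorphD, rmorphM).
  have Ega : ratC L ga = (ratC L a + ratC L b) * (ratC L m * ratC L k)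
      + ratC L n * ratC L k + ratC L l * ratC L m.
    by rewrite !(rmorphD, rmorphM).
  have Eka : ratC L ka' = ((ratC L m * ratC L a + ratC L n) ^+ 3 *
      (ratC L k * ratC L a + ratC L l)) / ((ratC L m * ratC L b + ratC L n) *
      (ratC L k * ratC L b + ratC L l) ^+ 3).
    by rewrite fmorph_div !(rmorphXn, rmorphM, rmorphD).
  have lin0 x y z : x * z + y != 0 -> ratC L x * ratC L z + ratC L y != 0.
    by rewrite -rmorphM -rmorphD ratC_eq0.
  have X0 x : ratX L - ratC L x != 0.
    by rewrite subr_eq0; apply/eqP; exact: nonconst_ratX.
  rewrite rmorphN Eka Eal Ebe Ega; apply: swap_form; rewrite ?lin0 ?X0 //.
  - rewrite -Eal -Ega -rmorphN.
    exact: ratmob_den_neq0 (@nonconst_ratX L) (det_row_neq0 det).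
  - exact: tofrac_linear_neq0 ma.
  - exact: tofrac_linear_neq0 kb.
have nh := nonconst_ratcomp_mob det nf.
have F10 : F1 f != 0.
  apply/eqP; rewrite -[0](rmorph0 (ratC L)); exact: nonconst_ratmob nf D1 0.
have F1f : F1 f = ratmob 0 ka' 1 0 (F1 (ratcomp f phi)).
  rewrite /ratmob /mob sw rmorph0 rmorph1 mul0r add0r mul1r addr0.
  by apply/esym/divKf; rewrite ratC_eq0; exact: ka'0.
have swf : post_equiv (F1 (ratcomp f phi)) (F1 f).
  by exists 0, ka', 1, 0; rewrite -F1f mul0r mulr1 sub0r oppr_eq0.
have toF1 h : post_equiv h (F1 h).
  by exists Q.[a], (- P.[a]), Q.[b], (- P.[b]).
(* The chain passes from [f] composed with [phi] to its image under [F1], then to [F1 f] by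
   [z -> ka' / z], then back to [f]. *)
apply: (post_equiv_trans nh (toF1 _)).
apply: (post_equiv_trans (post_equiv_nonconst nh (toF1 _)) swf).
by apply: post_equiv_sym => //; exact: toF1.
Qed.

End Swap.

(** * Ramification and the Wronskian *)

Section Ramification.
Variable L : closedFieldType.
Implicit Types (p : {poly L}) (f : {fraction {poly L}}).

Lemma valuation_ratfun (a : L) p d : p != 0 -> d != 0 ->
  valuation a (ratfun p d) = (mup a p)%:Z - (mup a d)%:Z.
Proof.
move=> p0 d0; have [u u0 [Ep Ed]] := ratfun_lowest p d0; rewrite /valuation.
set n := ratnum _ in Ep *; set e := ratden _ in Ed *.
have n0 : n != 0 by apply: contraNneq p0 => n0; rewrite Ep n0 mulr0.
have e0 : e != 0 by apply: contraNneq d0 => e0; rewrite Ed e0 mulr0.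
by rewrite Ep Ed !mupM // !PoszD opprD addrACA subrr add0r.
Qed.

Lemma mup_gt1 (a : L) p : p != 0 -> root p a ->
  (1 < mup a p)%N = root p^`() a.
Proof.
move=> p0 pa; rewrite mup_geq //; apply/idP/idP; last first.
  by move=> /(double_root pa)[s ->]; exact: dvdp_mull.
move=> /dvdpP[s ->]; rewrite derivM deriv_exp derivXsubC mul1r /=.
by rewrite /root !(hornerXsubC, hornerD, horner_exp, hornerM) subrr expr0n expr1
  addr0 !mulr0 addr0.
Qed.

Lemma ratfun0 d : ratfun 0 d = 0 :> {fraction {poly L}}.
Proof. by rewrite /ratfun tofrac0 mul0r. Qed.

Lemma ratfun_sub_cst f (c : L) :
  f - ratcst c = ratfun (ratnum f - c *: ratden f) (ratden f).
Proof.
rewrite /ratfun tofracB -mul_polyC tofracM mulrBl.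
by rewrite mulfK ?tofrac_eq0 ?ratden_neq0 // -[in LHS](ratfun_num_den f).
Qed.

Lemma ratfun_neq_cst f : nonconst f ->
  ratnum f != 0 /\ forall c, ratnum f - c *: ratden f != 0.
Proof.
move=> nf; have H c : ratnum f - c *: ratden f != 0.
  apply/eqP => E; apply: (nf c); apply/eqP; rewrite -subr_eq0 ratfun_sub_cst E.
  by rewrite ratfun0.
by split=> //; have := H 0; rewrite scale0r subr0.
Qed.

(** At a finite value [k], the derivative of [ratnum f - k *: ratden f] at [a] is the Wronskian
    divided by the nonzero [(ratden f).[a]]. At a pole the index is that of a zero of [1 / f], whose
    Wronskian differs by a sign. *)
Lemma ramified_wronsk f (a : L) :
  nonconst f -> ramified f (Some a) <-> root (ramW f) a.
Proof.
move=> nf; have [P0 PcQ] := ratfun_neq_cst nf; have Q0 := ratden_neq0 f.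
rewrite /ramified /ram_index /ram_index_fin /value_at.
have WE : (ramW f).[a] = (ratnum f)^`().[a] * (ratden f).[a] -
    (ratnum f).[a] * (ratden f)^`().[a].
  by rewrite /ramW /wronsk hornerD hornerN !hornerM.
have [Qa|Qa] := boolP (root (ratden f) a).
  have Pa : ~~ root (ratnum f) a.
    by apply/negP => /rootP /ratnum_ratden_root; rewrite (rootP Qa) eqxx.
  have -> : f^-1 = ratfun (ratden f) (ratnum f).
    by rewrite -{1}[f]ratfun_num_den /ratfun invf_div.
  rewrite valuation_ratfun // (mupNroot Pa) subr0 ltz_nat mup_gt1 //.
  rewrite /root WE (rootP Qa) mulr0 sub0r oppr_eq0 mulf_eq0.
  by rewrite -/(root (ratnum f) a) (negPf Pa).
set k := _ / _; rewrite ratfun_sub_cst valuation_ratfun // (mupNroot Qa) subr0.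
have kQ : k * (ratden f).[a] = (ratnum f).[a] by rewrite /k divfK.
rewrite ltz_nat mup_gt1 //; last first.
  by rewrite /root hornerD hornerN hornerZ kQ subrr.
rewrite /root WE -kQ derivD derivN derivZ hornerD hornerN hornerZ.
rewrite (_ : _ * _ - _ = (ratden f).[a] *
  ((ratnum f)^`().[a] - k * (ratden f)^`().[a])); last by ring.
by rewrite mulf_eq0 -/(root (ratden f) a) (negPf Qa).
Qed.

(** For a constant [f] the difference in the definition of the index is 0, and the default valuation
    of 0 does not exceed 1. *)
Lemma ramified_nonconst f (a : L) : ramified f (Some a) -> nonconst f.
Proof.
move=> rf k Ef; move: rf; rewrite /ramified /ram_index /ram_index_fin /value_at.
have PQ : ratnum f = k *: ratden f.
  have := ratfun_sub_cst f k; rewrite Ef subrr -Ef => /esym/eqP.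
  rewrite /ratfun mulf_eq0 invr_eq0 !tofrac_eq0 (negPf (ratden_neq0 f)) orbF.
  by rewrite subr_eq0 => /eqP.
have Qa : (ratden f).[a] != 0.
  have [|Pa] := eqVneq (ratnum f).[a] 0; first exact: ratnum_ratden_root.
  by apply: contraNneq Pa => Qa; rewrite PQ hornerZ Qa mulr0.
rewrite /root (negPf Qa) PQ hornerZ mulfK // Ef subrr.
have n0 : ratnum (0 : {fraction {poly L}}) = 0.
  have /eqP := ratfun_num_den (0 : {fraction {poly L}}).
  rewrite /ratfun mulf_eq0 invr_eq0 !tofrac_eq0 (negPf (ratden_neq0 _)) orbF.
  by move/eqP.
(* [mup] is bounded by the size of its argument, which is 0 here. *)
have m0 : mup a (0 : {poly L}) = 0.
  have : (mup a (0%R : {poly L}) < (size (0%R : {poly L})).+1)%N := ltn_ord _.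
  by rewrite size_poly0 ltnS leqn0 => /eqP.
by rewrite /valuation n0 m0 sub0r; case: (mup a _).
Qed.

(** The Wronskian has degree at most 4, so four distinct roots force degree 4 and leave no room for
    a double root. *)
Lemma size_ramW f (s : seq L) : cubic f -> size s = 4 -> uniq s ->
    (forall a, root (ramW f) a <-> a \in s) ->
  size (ramW f) = 5 /\ forall a, a \in s -> ~~ (('X - a%:P) ^+ 2 %| ramW f).
Proof.
move=> /cubic_lowest[sP sQ] s4 us Ws.
have W0 : ramW f != 0.
  (* A root of [p] lies outside [s], whereas a zero Wronskian would have every point as a root. *)
  pose p := \prod_(x <- s) ('X - x%:P) + 1.
  have sp : size p = 5.
    by rewrite size_polyDl size_prod_XsubC ?s4 // size_poly1.
  have /closed_rootP[x px] : size p != 1 by rewrite sp.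
  apply/eqP => W0; have /Ws : root (ramW f) x by rewrite W0 root0.
  rewrite -root_prod_XsubC => /rootP E; move: px.
  by rewrite /root hornerD E add0r hornerE oner_eq0.
have sW : (size (ramW f) <= 5)%N.
  rewrite /ramW; have [w0 [w1 [w2 [w3 [w4 [-> _]]]]]] := wronsk_form sP sQ.
  have sD (p q : {poly L}) : (size p <= 5)%N -> (size q <= 5)%N ->
      (size (p + q)%R <= 5)%N.
    by move=> sp sq; rewrite (leq_trans (size_polyD _ _)) // geq_max sp.
  have sX (w : L) n : (n <= 4)%N -> (size (w *: 'X^n)%R <= 5)%N.
    by move=> n4; rewrite (leq_trans (size_scale_leq _ _)) // size_polyXn.
  rewrite /form4 !expr1n !mulr1.
  by rewrite !sD ?sX // (leq_trans (size_scale_leq _ _)) // ?size_poly1 ?size_polyX.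
have sW5 : size (ramW f) = 5.
  apply/eqP; rewrite eqn_leq sW; have : (size s < size (ramW f))%N; last by rewrite s4.
  by apply: max_poly_roots => //; apply/allP => x /Ws.
split=> // a sa; apply/negP => /dvdpP[r Er].
have r0 : r != 0 by apply: contraNneq W0 => r0; rewrite Er r0 mul0r.
have sr : size r = 3.
  move: sW5; rewrite Er size_Mmonic ?monic_exp ?monicXsubC // size_exp_XsubC.
  by rewrite addn3 => -[].
(* The quadratic cofactor [r] would have the three other points as roots. *)
have : (size (rem a s) < size r)%N.
  apply: max_poly_roots => //; last exact: rem_uniq.
  apply/allP => x; rewrite mem_rem_uniq // inE => /andP[xa /Ws].
  by rewrite Er rootM => /orP[//|/rootP]; rewrite horner_exp hornerXsubC =>
    /eqP; rewrite expf_eq0 subr_eq0 (negPf xa).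
by rewrite size_rem // s4 sr.
Qed.

End Ramification.

(** * Cross ratios *)

Section CrossRatio.
Variable K : fieldType.
Implicit Types x y a b c d : K.

Definition lam x1 x2 x3 x4 :=
  cross_ratio x1 x2 x3 x4 + (cross_ratio x1 x2 x3 x4)^-1.

Lemma cross_ratio_mob a b c d x1 x2 x3 x4 : a * d - b * c != 0 ->
    c * x1 + d != 0 -> c * x2 + d != 0 -> c * x3 + d != 0 -> c * x4 + d != 0 ->
    x1 != x4 -> x2 != x3 ->
  cross_ratio (mob a b c d x1) (mob a b c d x2) (mob a b c d x3) (mob a b c d x4)
  = cross_ratio x1 x2 x3 x4.
Proof.
move=> D v1 v2 v3 v4 x14 x23; rewrite -subr_eq0 in x14; rewrite -subr_eq0 in x23.
have E x y : c * x + d != 0 -> c * y + d != 0 -> mob a b c d x - mob a b c d y =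
    (a * d - b * c) * (x - y) / ((c * x + d) * (c * y + d)).
  by move=> vx vy; rewrite /mob; field; rewrite vx vy.
rewrite /cross_ratio !E //.
move: D v1 v2 v3 v4 x14 x23.
move: (a * d - b * c) (c * x1 + d) (c * x2 + d) (c * x3 + d) (c * x4 + d).
move: (x1 - x4) (x2 - x3) => y14 y23 D v1 v2 v3 v4 *; field.
by repeat (apply/andP; split).
Qed.

Lemma lam_swap x1 x2 x3 x4 : lam x1 x2 x4 x3 = lam x1 x2 x3 x4.
Proof. by rewrite /lam /cross_ratio invf_div addrC invf_div. Qed.

Lemma cross_ratio_compl x1 x2 x3 x4 : x1 != x4 -> x2 != x3 ->
  cross_ratio x1 x3 x2 x4 = 1 - cross_ratio x1 x2 x3 x4.
Proof.
move=> x14 x23; rewrite /cross_ratio; field.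
rewrite !subr_eq0. by rewrite ?x14 ?x23 // 1?eq_sym x23.
Qed.

(** The middle exchange replaces [C] by [1 - C], and equality of the two values becomes
    [(1 - 2 C) (C (1 - C) - 1) = 0]. The first factor gives [C = 1 / 2] and the value [5 / 2], the
    second gives [C^-1 = 1 - C] and the value [1]. *)
Lemma lam_compl x1 x2 x3 x4 : uniq [:: x1; x2; x3; x4] ->
    lam x1 x3 x2 x4 = lam x1 x2 x3 x4 ->
  lam x1 x2 x3 x4 = 1 \/ lam x1 x2 x3 x4 = 5%:R / 2%:R.
Proof.
rewrite /= !inE !negb_or !andbT -!andbA => /and5P[x12 x13 x14 x23 /andP[x24 x34]].
have C0 : cross_ratio x1 x2 x3 x4 != 0.
  by rewrite /cross_ratio !(mulf_neq0, invr_neq0) // subr_eq0.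
have : cross_ratio x1 x3 x2 x4 != 0.
  by rewrite /cross_ratio !(mulf_neq0, invr_neq0) // subr_eq0 // eq_sym.
rewrite /lam cross_ratio_compl //.
move: C0; set C := cross_ratio _ _ _ _; move=> C0 C1 E.
have /eqP : (1 - 2%:R * C) * (C * (1 - C) - 1) = 0.
  transitivity ((C * (1 - C)) * ((1 - C + (1 - C)^-1) - (C + C^-1))).
    by field; rewrite C0 C1.
  by rewrite E subrr mulr0.
rewrite mulf_eq0 !subr_eq0 => /orP[/eqP C2|/eqP C2]; [right|left].
  (* In characteristic 2 the equation [1 = 2 C] has no solution. *)
  have two0 : 2%:R != 0 :> K.
    by apply: contra_eq_neq C2 => ->; rewrite mul0r oner_neq0.
  have -> : C = 2%:R^-1 by apply: (mulfI two0); rewrite -C2 divff.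
  by rewrite invrK; field; exact: two0.
have -> : C^-1 = 1 - C by apply: (mulfI C0); rewrite divff // C2.
by rewrite addrC subrK.
Qed.

End CrossRatio.

(** With [x1] fixed, the six orders of the other points form three pairs under [lam_swap], one for
    each partner of [x1]. By [lam_compl], the partners [x3] and [x4] give values different from that
    of [x2]. *)
Lemma lam_pairing (K : fieldType) (x1 x2 x3 x4 z2 z3 z4 : K) :
    uniq [:: x1; x2; x3; x4] -> uniq [:: x1; z2; z3; z4] ->
    z2 \in [:: x1; x2; x3; x4] -> z3 \in [:: x1; x2; x3; x4] ->
    z4 \in [:: x1; x2; x3; x4] ->
    lam x1 z2 z3 z4 = lam x1 x2 x3 x4 ->
    lam x1 x2 x3 x4 <> 1 -> lam x1 x2 x3 x4 <> 5%:R / 2%:R ->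
  z2 = x2 /\ (z3 = x3 /\ z4 = x4 \/ z3 = x4 /\ z4 = x3).
Proof.
move=> ux uz; rewrite !inE => X2 X3 X4 E l1 l2.
have no3 : lam x1 x3 x2 x4 <> lam x1 x2 x3 x4.
  by move=> /(lam_compl ux)[].
have no4 : lam x1 x4 x2 x3 <> lam x1 x2 x3 x4.
  have ux' : uniq [:: x1; x2; x4; x3].
    rewrite (perm_uniq (s2 := [:: x1; x2; x3; x4])) // !perm_cons.
    exact: (permEl (perm_catC [:: x4] [:: x3])).
  by rewrite -(lam_swap x1 x2 x3) => /(lam_compl ux'); rewrite lam_swap => -[].
move: uz E.
by case/or4P: X2 => /eqP->; case/or4P: X3 => /eqP->; case/or4P: X4 => /eqP->;
  rewrite /= ?inE ?(eqxx, orbT, andbF, orTb) //= => _ E; auto; exfalso;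
  move: E; rewrite ?[lam _ _ x4 x2]lam_swap ?[lam _ _ x3 x2]lam_swap; auto.
Qed.

(** * Frobenius descent *)

Section FracMap.
Variables (K K' : fieldType) (tau : {rmorphism K -> K'}).

Definition fracmap_poly : {rmorphism {poly K} -> {fraction {poly K'}}} :=
  @tofrac {poly K'} \o map_poly tau.

Lemma fracmap_poly_inj p : fracmap_poly p = 0 -> p = 0.
Proof. by move=> /eqP /=; rewrite tofrac_eq0 map_poly_eq0 => /eqP. Qed.

Definition fracmap : {rmorphism {fraction {poly K}} -> {fraction {poly K'}}} :=
  fraclift fracmap_poly_inj.

Lemma fracmap_ratfun p q : q != 0 ->
  fracmap (ratfun p q) = ratfun (map_poly tau p) (map_poly tau q).
Proof. exact: fraclift_ratfun. Qed.

Lemma fracmapC c : fracmap (ratC K c) = ratC K' (tau c).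
Proof.
apply: (etrans (fraclift_tofrac fracmap_poly_inj _)).
by rewrite /= map_polyC.
Qed.

Lemma fracmapX : fracmap (ratX K) = ratX K'.
Proof.
apply: (etrans (fraclift_tofrac fracmap_poly_inj _)).
by rewrite /= map_polyX.
Qed.

Lemma fracmap_ratmob a b c d f : fracmap (ratmob a b c d f) =
  ratmob (tau a) (tau b) (tau c) (tau d) (fracmap f).
Proof.
by rewrite /ratmob /mob fmorph_div !rmorphD !rmorphM !fracmapC.
Qed.

Lemma fracmap_polyAt p h :
  fracmap (polyAt h p) = polyAt (fracmap h) (map_poly tau p).
Proof.
elim/poly_ind: p => [|p c IH]; first by rewrite !rmorph0.
have -> : map_poly tau (p * 'X + c%:P) = map_poly tau p * 'X + (tau c)%:P.
  by rewrite rmorphD rmorphM /= map_polyX map_polyC.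
by rewrite !rmorphD !rmorphM IH !polyAtC !polyAtX fracmapC.
Qed.

Lemma fracmap_ratcomp f h : transc (fracmap h) ->
  fracmap (ratcomp f h) = ratcomp (fracmap f) (fracmap h).
Proof.
move=> th; rewrite -[in RHS](ratfun_num_den f) fracmap_ratfun ?ratden_neq0 //.
rewrite ratcomp_ratfun ?map_poly_eq0 ?ratden_neq0 // -!fracmap_polyAt.
by rewrite -fmorph_div.
Qed.

End FracMap.

Section Frobenius.
Variables (F : finFieldType) (L : closedFieldType) (iota : {rmorphism F -> L}).
Implicit Types (a b c d x y : L).

Definition frob of {rmorphism F -> L} := fun x : L => x ^+ #|F|.

Lemma frob_is_zmod_morphism : zmod_morphism (frob iota).
Proof.
have [p p_pr pF] := finPcharP F; have pL := rmorph_pchar iota pF.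
(* The additive group of [F] is an elementary abelian [p]-group, so its order is a power of [p]. *)
have pn : ([pchar L]).-nat #|F|.
  rewrite (eq_pnat _ (pcharf_eq pL)) -cardsT.
  exact: abelian.abelem_pgroup (abelian.fin_ring_pchar_abelem pF).
move=> x y; rewrite /frob exprDn_pchar //; congr (_ + _).
apply/eqP; rewrite -subr_eq0 opprK -exprDn_pchar // addNr expr0n.
by rewrite eqn0Ngt ltnW ?finNzRing_gt1.
Qed.

Lemma frob_is_monoid_morphism : monoid_morphism (frob iota).
Proof. by split=> [|x y]; rewrite /frob ?expr1n ?exprMn. Qed.

HB.instance Definition _ :=
  GRing.isZmodMorphism.Build L L (frob iota) frob_is_zmod_morphism.
HB.instance Definition _ :=
  GRing.isMonoidMorphism.Build L L (frob iota) frob_is_monoid_morphism.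

Lemma frob_iota z : frob iota (iota z) = iota z.
Proof. by rewrite /frob -rmorphXn expf_card. Qed.

(** A fixed point is a root of [X^q - X], which is the product of the [X - z] over all [z] in
    [F]. *)
Lemma frob_fixed x : frob iota x = x -> exists z, x = iota z.
Proof.
move=> xq; have : root (map_poly iota ('X^#|F| - 'X)) x.
  by rewrite rmorphB /= map_polyXn map_polyX /root hornerD hornerN hornerXn hornerX
    -/(frob iota x) xq subrr.
rewrite finField_genPoly rmorph_prod /root horner_prod prodf_seq_eq0.
case/hasP => z _; rewrite rmorphB /= map_polyX map_polyC hornerXsubC subr_eq0.
by move=> /eqP ->; exists z.
Qed.

(** Otherwise [x] and its first two conjugates would be three distinct roots of a quadratic
    polynomial. *)
Lemma frob_frob_deg2 x : degree_two iota x -> x != frob iota x ->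
  frob iota (frob iota x) = x.
Proof.
move=> [p [_ sp px]] xq; apply/eqP; apply: contraT => xqq.
have rq y : root (map_poly iota p) y -> root (map_poly iota p) (frob iota y).
  move=> /rootP py; apply/rootP; rewrite -[RHS](rmorph0 (frob iota)) -py.
  rewrite -horner_map -map_poly_comp; congr _.[_]; apply: eq_map_poly => z /=.
  by rewrite frob_iota.
have : (size [:: x; frob iota x; frob iota (frob iota x)] < size (map_poly iota p))%N.
  apply: max_poly_roots.
  - by rewrite map_poly_eq0 -size_poly_eq0 sp.
  - by rewrite /= px !rq.
  rewrite /= !inE negb_or xq eq_sym xqq /= andbT.
  by apply: contra xq => /eqP /fmorph_inj <-.
by rewrite size_map_poly sp.
Qed.

(** The hypothesis says that the Moebius map equals its Frobenius conjugate. Dividing the matrix by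
    [c], or by [d] if [c = 0], makes its entries fixed by Frobenius, hence elements of [F]. *)
Lemma frob_fixed_mob a b c d : a * d - b * c != 0 ->
    (a *: 'X + b%:P) * (frob iota c *: 'X + (frob iota d)%:P) =
    (frob iota a *: 'X + (frob iota b)%:P) * (c *: 'X + d%:P) ->
  exists (k : L) (a0 b0 c0 d0 : F), [/\ k != 0, a0 * d0 - b0 * c0 != 0,
    a = k * iota a0 /\ b = k * iota b0 & c = k * iota c0 /\ d = k * iota d0].
Proof.
move=> D E.
have [k k0 [fa [fb [fc fd]]]] : exists2 k : L, k != 0 & [/\ frob iota (a / k) = a / k,
   frob iota (b / k) = b / k, frob iota (c / k) = c / k &
   frob iota (d / k) = d / k].
  have prod_coef (p q r s : L) : (p *: 'X + q%:P) * (r *: 'X + s%:P) =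
      (p * r) *: 'X^2 + (p * s + q * r) *: 'X + (q * s)%:P.
    by rewrite -!mul_polyC polyCD !polyCM; ring.
  move: E; rewrite !prod_coef => E.
  have Ei i := congr1 (fun p : {poly L} => p`_i) E.
  have := Ei 0; have := Ei 1; have := Ei 2; clear Ei E.
  rewrite !coefD !coefZ !coefXn !coefX !coefC /= !(mulr0, mulr1, addr0, add0r).
  have Fd x y : frob iota (x / y) = frob iota x / frob iota y.
    exact: (fmorph_div (frob iota)).
  set a' := frob _ a; set b' := frob _ b; set c' := frob _ c; set d' := frob _ d.
  move=> E2 E1 E0; have [c0|c0] := eqVneq c 0.
    have c'0 : c' = 0 by rewrite /c' c0 rmorph0.
    have d0 : d != 0 by apply: contraNneq D => ->; rewrite c0 !mulr0 subrr.
    have d'0 : d' != 0 by rewrite fmorph_eq0.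
    exists d => //; rewrite !Fd -/a' -/b' -/c' -/d' c0 c'0 !mul0r !divff //; split=> //.
      by apply/eqP; rewrite eqr_div //; move: E1; rewrite c0 c'0 !mulr0 !addr0 => ->.
    by apply/eqP; rewrite eqr_div // -E0.
  have c'0 : c' != 0 by rewrite fmorph_eq0.
  have Ea : a' / c' = a / c by apply/eqP; rewrite eqr_div // -E2.
  (* This is the hypothesis read at [X = - d / c]: the right side vanishes there, while [a X + b]
     does not since the determinant is nonzero. *)
  have Ed : d' / c' = d / c.
    have /eqP : (a * d - b * c) * (d' / c' - d / c) = 0.
      have -> : (a * d - b * c) * (d' / c' - d / c) =
        ((a * d' + b * c') * d * c - (b * d') * c ^+ 2 - (a * c') * d ^+ 2) / (c * c').
        by field; rewrite c0 c'0.
      rewrite E1 E0 E2.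
      apply/eqP; rewrite mulf_eq0; apply/orP; left; apply/eqP; ring.
    by rewrite mulf_eq0 (negPf D) subr_eq0 => /eqP.
  exists c => //; rewrite !Fd -/a' -/b' -/c' -/d' !divff //; split=> //.
  have : (a * d' + b * c') / (c * c') = (a' * d + b' * c) / (c * c') by rewrite E1.
  have -> : (a * d' + b * c') / (c * c') = (a / c) * (d' / c') + b / c.
    by field; rewrite c0 c'0.
  have -> : (a' * d + b' * c) / (c * c') = (a' / c') * (d / c) + b' / c'.
    by field; rewrite c0 c'0.
  by rewrite Ea Ed => /addrI.
have [a0 Ea] := frob_fixed fa; have [b0 Eb] := frob_fixed fb.
have [c0 Ec] := frob_fixed fc; have [d0 Ed] := frob_fixed fd.
have K x y : x / k = y -> x = k * y by move=> <-; rewrite mulrCA divff ?mulr1.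
move: Ea Eb Ec Ed => /K Ea /K Eb /K Ec /K Ed.
exists k, a0, b0, c0, d0; split=> //.
apply: contraNneq D => D0; rewrite Ea Eb Ec Ed; apply/eqP.
transitivity (k ^+ 2 * iota (a0 * d0 - b0 * c0)).
  by rewrite rmorphB !rmorphM; ring.
by rewrite D0 rmorph0 mulr0.
Qed.

End Frobenius.

Lemma div_eq_cross (K : fieldType) (x y z t : K) : y != 0 -> t != 0 ->
  x / y = z / t -> x * t = z * y.
Proof. by move=> y0 t0 /eqP; rewrite eqr_div // => /eqP. Qed.

Lemma rmorph_mob (K K' : fieldType) (tau : {rmorphism K -> K'}) a b c d x :
  tau (mob a b c d x) = mob (tau a) (tau b) (tau c) (tau d) (tau x).
Proof. by rewrite /mob fmorph_div !rmorphD !rmorphM. Qed.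

Section Descent.
Variables (F : finFieldType) (L : closedFieldType) (iota : {rmorphism F -> L}).
Local Notation sigma := (frob iota).

Lemma polyAt_linear (K : fieldType) (h : {fraction {poly K}}) a b :
  polyAt h (a *: 'X + b%:P) = ratC K a * h + ratC K b.
Proof.
by rewrite -mul_polyC -['X]expr1 rmorphD polyAtCXn expr1; congr (_ + _);
   exact: polyAtC.
Qed.

Lemma fracmap_frob_iota g :
  fracmap sigma (fracmap iota g) = fracmap iota g.
Proof.
rewrite -[g]ratfun_num_den !fracmap_ratfun ?map_poly_eq0 ?ratden_neq0 //.
by congr ratfun; rewrite -map_poly_comp; apply: eq_map_poly => z /=;
   rewrite frob_iota.
Qed.

(** Applying Frobenius to the coefficients fixes both functions and conjugates the outer map. As the
    inner function is transcendental, it determines the outer map, which is therefore its own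
    conjugate. *)
Lemma post_equiv_descent (h g : {fraction {poly F}}) :
    nonconst (fracmap iota h) -> post_equiv (fracmap iota h) (fracmap iota g) ->
  exists a b c d, a * d - b * c != 0 /\ g = ratmob a b c d h.
Proof.
move=> nh [a [b [c [d [D Eg]]]]].
have D' : sigma a * sigma d - sigma b * sigma c != 0.
  by rewrite -!rmorphM -rmorphB fmorph_eq0.
have Eg' : fracmap iota g =
    ratmob (sigma a) (sigma b) (sigma c) (sigma d) (fracmap iota h).
  by rewrite -fracmap_frob_iota {1}Eg fracmap_ratmob fracmap_frob_iota.
have E : (a *: 'X + b%:P) * (sigma c *: 'X + (sigma d)%:P) =
    (sigma a *: 'X + (sigma b)%:P) * (c *: 'X + d%:P).
  apply/eqP; rewrite -subr_eq0; apply/eqP/(nonconst_transc nh).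
  rewrite rmorphB !rmorphM; apply/eqP; rewrite subr_eq0.
  have den := ratmob_den_neq0 nh (det_row_neq0 D).
  have den' := ratmob_den_neq0 nh (det_row_neq0 D').
  rewrite Eg in Eg'; rewrite !polyAt_linear; apply/eqP.
  exact: (div_eq_cross den den' Eg').
have [k [a0 [b0 [c0 [d0 [k0 D0 [Ea Eb] [Ec Ed]]]]]]] := frob_fixed_mob D E.
exists a0, b0, c0, d0; split=> //; apply: (fmorph_inj (fracmap iota)).
by rewrite fracmap_ratmob Eg Ea Eb Ec Ed ratmob_scale.
Qed.

(** Cross-multiplying the map and its conjugate gives a difference of degree at most 2 that vanishes
    on [s], hence is 0. *)
Lemma mob_descent a b c d (s : seq L) : a * d - b * c != 0 ->
    uniq s -> (2 < size s)%N ->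
    (forall y, y \in s -> c * y + d != 0) ->
    (forall y, y \in s -> sigma y \in s) -> {in s, involutive sigma} ->
    (forall y, y \in s -> sigma (mob a b c d y) = mob a b c d (sigma y)) ->
  exists (k : L) (a0 b0 c0 d0 : F), [/\ k != 0, a0 * d0 - b0 * c0 != 0,
    a = k * iota a0 /\ b = k * iota b0 & c = k * iota c0 /\ d = k * iota d0].
Proof.
move=> D us s2 den sS sK com; apply: frob_fixed_mob => //.
apply/eqP; rewrite -subr_eq0; set p := _ - _; apply: contraT => p0.
have sp : (size p <= 3)%N.
  rewrite (leq_trans (size_polyD _ _)) // geq_max size_polyN.
  have sM (u v : {poly L}) : (size u <= 2)%N -> (size v <= 2)%N ->
      (size (u * v)%R <= 3)%N.
    move=> su sv; rewrite (leq_trans (size_polyMleq _ _)) //.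
    by rewrite -subn1 leq_subLR (leq_add su sv).
  by rewrite !sM ?size_mobius.
suff : (size s < size p)%N by rewrite ltnNge (leq_trans sp s2).
apply: max_poly_roots => //; apply/allP => y ys.
rewrite /root /p hornerD hornerN !hornerM !hornerD !hornerZ !hornerX !hornerC.
have Ey : y = sigma (sigma y) by rewrite sK.
have den' : sigma c * y + sigma d != 0.
  by rewrite Ey -rmorphM -rmorphD fmorph_eq0 den ?sS.
(* This is the commutation at [sigma y], with Frobenius then moved onto the coefficients. *)
have com' : mob a b c d y = mob (sigma a) (sigma b) (sigma c) (sigma d) y.
  rewrite [in RHS]Ey; apply: etrans (rmorph_mob sigma a b c d (sigma y)).
  by apply: esym; apply: (etrans (com _ (sS _ ys))); rewrite -Ey.
by rewrite subr_eq0; apply/eqP; exact: div_eq_cross (den _ ys) den' com'.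
Qed.

End Descent.

(** * Matching the ramification points of two functions *)

Section Points.
Variable L : closedFieldType.
Implicit Types (f g : {fraction {poly L}}).

(** The value [u] determines the normal form: 0 selects the first, and a nonzero [u] gives back [t]
    as its inverse. *)
Lemma theta_common f g u : theta_is f u -> theta_is g u ->
  exists N : {fraction {poly L}}, [/\ cubic N, equivalent f N & equivalent g N].
Proof.
have cub e (t : L) : cubic (ratfun ('X^3 + e *: 'X^2 + t%:P) 'X).
  exists ('X^3 + e *: 'X^2 + t%:P), 'X; rewrite size_polyX polyX_eq0; split=> //.
  rewrite !(leq_trans (size_polyD _ _)) // geq_max (leq_trans (size_polyC_leq1 _)) //.
  rewrite andbT (leq_trans (size_polyD _ _)) // geq_max size_polyXn /=.
  by rewrite (leq_trans (size_scale_leq _ _)) // size_polyXn.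
case=> [[fN u0]|[t [t0 fN ut]]] [[gN u0']|[t' [t0' gN ut']]].
- exists (ratfun ('X^3 + 1) 'X); split=> //.
  by have := cub 0 1; rewrite scale0r addr0.
- by move: t0'; rewrite -invr_eq0 -ut' u0 eqxx.
- by move: t0; rewrite -invr_eq0 -ut u0' eqxx.
exists (ratfun ('X^3 + 'X^2 + t%:P) 'X); split=> //.
  by have := cub 1 t; rewrite scale1r.
by move: gN; rewrite (_ : t' = t) //; apply: invr_inj; rewrite -ut -ut'.
Qed.

Lemma equivalent_common f g N : nonconst f -> nonconst g ->
    cubic N -> equivalent f N -> equivalent g N ->
  [/\ cubic f, cubic g & exists a b c d, moved a b c d f g].
Proof.
move=> nf ng cN /(equivalent_moved nf)[a [b [c [d fN]]]].
move=> /(equivalent_moved ng)[a' [b' [c' [d' gN]]]].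
have nN := moved_nonconst nf fN.
have Nf := moved_sym nf fN; have Ng := moved_sym ng gN.
split; [exact: cubic_moved Nf|exact: cubic_moved Ng|].
by have := moved_trans nf fN Ng; do 4!eexists; eassumption.
Qed.

(** The given inner map sends [y] to some [z] in [s]; if [z] is not [x], following it by the map of
    [ram_swap] from [z] to [x] corrects this without changing [f]. *)
Lemma moved_to f g (s : seq L) x y :
    nonconst f -> cubic f -> size s = 4 -> uniq s ->
    (forall z, root (ramW f) z <-> z \in s) -> x \in s -> root (ramW g) y ->
    (exists a b c d, moved a b c d f g) ->
  exists a b c d, moved a b c d f g /\ mob a b c d y = x.
Proof.
move=> nf cf s4 us Ws xs Wy [a [b [c [d fg]]]].
have [s5 simple] := size_ramW cf s4 us Ws.
have [v0 Wz] := moved_root nf cf s5 fg Wy.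
set z := _ / _ in Wz.
have [zx|zx] := eqVneq z x; first by exists a, b, c, d.
have [al [be [ga [de [ff v1 E]]]]] := ram_swap nf cf zx Wz
  (simple _ ((Ws z).1 Wz)) ((Ws x).2 xs) (simple _ xs).
exists (al * a + be * c), (al * b + be * d), (ga * a + de * c), (ga * b + de * d).
split; first exact: moved_trans nf ff fg.
rewrite -mob_comp // -[mob a b c d y]/z /mob E mulfK //.
Qed.

Lemma mob_inj (a b c d x y : L) : a * d - b * c != 0 ->
  c * x + d != 0 -> c * y + d != 0 -> mob a b c d x = mob a b c d y -> x = y.
Proof.
move=> D vx vy /eqP; rewrite /mob eqr_div // -subr_eq0.
rewrite (_ : _ - _ = (a * d - b * c) * (x - y)); last by ring.
by rewrite mulf_eq0 (negPf D) subr_eq0 => /eqP.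
Qed.

End Points.

(* F is F_q with q = #|F|, and (L, iota) is an algebraic closure of F. *)
Theorem theorem8p4 (F : finFieldType) (L : closedFieldType)
    (iota : {rmorphism F -> L}) (iota_alg : integralRange iota)
    (f g : {fraction {poly F}}) (hf : classIIIb f) (hg : classIIIb g)
    (u : L) (thf : theta_is (ratmap iota f) u)
    (thg : theta_is (ratmap iota g) u)
    (l : L) (laf : lambda_is iota f l) (lag : lambda_is iota g l)
    (l_neq1 : l <> 1) (l_neq52 : l <> 5%:R / 2%:R) :
  equivalent f g.
Proof.
have RM k : ratmap iota k = fracmap iota k.
  by rewrite -[in RHS](ratfun_num_den k) fracmap_ratfun ?ratden_neq0.
case: laf => x1 [x3 [[dx1 dx3] ux Rf El]].
case: lag => y1 [y3 [[dy1 dy3] uy Rg El']].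
move: thf thg Rf Rg; rewrite !RM.
set fL := fracmap iota f; set gL := fracmap iota g => thf thg Rf Rg.
set x2 := x1 ^+ #|F| in ux El Rf; set x4 := x3 ^+ #|F| in ux El Rf.
set y2 := y1 ^+ #|F| in uy El' Rg; set y4 := y3 ^+ #|F| in uy El' Rg.
set xs := [:: x1; x2; x3; x4] in ux; set ys := [:: y1; y2; y3; y4] in uy.
have nf : nonconst fL by apply: (@ramified_nonconst _ _ x1); apply/Rf; rewrite !inE eqxx.
have ng : nonconst gL by apply: (@ramified_nonconst _ _ y1); apply/Rg; rewrite !inE eqxx.
have Wf z : root (ramW fL) z <-> z \in xs.
  by rewrite -(ramified_wronsk z nf) Rf !inE.
have Wg z : root (ramW gL) z <-> z \in ys.
  by rewrite -(ramified_wronsk z ng) Rg !inE.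
have [N [cN fN gN]] := theta_common thf thg.
have [cf cg fg] := equivalent_common nf ng cN fN gN.
have xs1 : x1 \in xs by rewrite inE eqxx.
have ys1 : root (ramW gL) y1 by apply/Wg; rewrite inE eqxx.
have [a [b [c [d [{}fg E1]]]]] := moved_to nf cf (erefl : size xs = 4) ux Wf xs1 ys1 fg.
have [s5 _] := size_ramW cf (erefl : size xs = 4) ux Wf.
have D := fg.1.
have im y : y \in ys -> c * y + d != 0 /\ mob a b c d y \in xs.
  by move=> /Wg /(moved_root nf cf s5 fg)[v0 /Wf].
have ysP : [/\ y1 \in ys, y2 \in ys, y3 \in ys & y4 \in ys].
  by rewrite !inE !eqxx !orbT.
have [Y1 Y2 Y3 Y4] := ysP.
have [v1 _] := im _ Y1; have [v2 X2] := im _ Y2.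
have [v3 X3] := im _ Y3; have [v4 X4] := im _ Y4.
have uz : uniq [:: x1; mob a b c d y2; mob a b c d y3; mob a b c d y4].
  rewrite -E1; change (uniq (map (mob a b c d) ys)).
  rewrite map_inj_in_uniq // => y z /im[vy _] /im[vz _].
  exact: mob_inj.
have lx : lam x1 x2 x3 x4 = l by rewrite El.
(* The cross ratio is invariant under the inner map, which sends [y1] to [x1]. *)
have lz : lam x1 (mob a b c d y2) (mob a b c d y3) (mob a b c d y4)
    = lam x1 x2 x3 x4.
  rewrite lx El' -E1 /lam cross_ratio_mob //.
    by move: uy; rewrite /= !inE !negb_or -!andbA => /and5P[].
  by move: uy; rewrite /= !inE !negb_or -!andbA => /and5P[].
rewrite -lx in l_neq1 l_neq52.
(* Conjugate pairs thus go to conjugate pairs. The order of [x3] and [x4] remains open, but the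
   inner map commutes with Frobenius in either case. *)
have [E2 E34] := lam_pairing ux uz X2 X3 X4 lz l_neq1 l_neq52.
have [Sx1 Sx3 Sy1 Sy3] : [/\ frob iota x2 = x1, frob iota x4 = x3,
    frob iota y2 = y1 & frob iota y4 = y3].
  move: ux uy; rewrite /= !inE !negb_or -!andbA.
  case/and5P=> x12 _ _ _ /andP[_ /andP[x34 _]].
  case/and5P=> y12 _ _ _ /andP[_ /andP[y34 _]].
  by split; apply: frob_frob_deg2.
have Sy2 : frob iota y1 = y2 by [].
have Sy4 : frob iota y3 = y4 by [].
have [] := @mob_descent F L iota a b c d ys D uy isT.
- by move=> y /im[].
- by move=> y; rewrite !inE => /or4P[] /eqP->;
     rewrite ?(Sy1, Sy2, Sy3, Sy4) eqxx ?orbT.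
- by move=> y; rewrite !inE => /or4P[] /eqP->; rewrite ?(Sy1, Sy2, Sy3, Sy4).
- move=> y; rewrite !inE => /or4P[] /eqP->; rewrite ?(Sy1, Sy2, Sy3, Sy4).
  + by rewrite E1 E2.
  + by rewrite E1 E2.
  + by case: E34 => -[-> ->].
  + by case: E34 => -[-> ->].
move=> k [a0 [b0 [c0 [d0 [k0 D0 [Ea Eb] [Ec Ed]]]]]].
pose phi := ratmob a0 b0 c0 d0 (ratX F).
have Ephi : fracmap iota phi = ratmob a b c d (ratX L).
  by rewrite fracmap_ratmob fracmapX Ea Eb Ec Ed ratmob_scale.
have th : transc (fracmap iota phi) by rewrite Ephi; exact: ratmobX_transc.
pose h := ratcomp f phi.
have Eh : fracmap iota h = ratcomp fL (ratmob a b c d (ratX L)).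
  by rewrite fracmap_ratcomp // Ephi.
have nh : nonconst (fracmap iota h) by rewrite Eh; exact: nonconst_ratcomp_mob.
(* With the inner map now defined over [F], both [h] and [g] are, and the outer map descends as
   well. *)
have [] := @post_equiv_descent F L iota h g nh; first by rewrite Eh; exact: fg.2.
move=> a1 [b1 [c1 [d1 [D1 Eg]]]].
exists (ratfun (a1 *: 'X + b1%:P) (c1 *: 'X + d1%:P)).
exists (ratfun (a0 *: 'X + b0%:P) (c0 *: 'X + d0%:P)).
split; [by exists a1, b1, c1, d1|by exists a0, b0, c0, d0|].
rewrite !ratfun_ratmob -/phi -/h.
have tL := nonconst_transc nh; apply: (fmorph_inj (fracmap iota)).
by rewrite Eg fracmap_ratcomp // !fracmap_ratmob ratcomp_ratmob // fracmapX ratcompX.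
Qed.
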